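(* Let $q$ be a prime power with $q\equiv3\pmod4$ and let $n$ be a positive integer with $8\mid n$ and every prime divisor of $n$ dividing $q-1$. Let $f\in\mathbb F_q[x]$ be an irreducible polynomial of odd degree $k$ and order $e$ with $\gcd(n,ek)=1$. Let $d=\gcd(n,q^2-1)$, let $\theta\in\mathbb F_{q^2}^*$ have multiplicative order $d$, let $m=n/d$, let $r$ be a positive integer with $nr\equiv1\pmod e$, let $\alpha$ be a root of $f$, and for each positive divisor $t$ of $m$ let $g_t(x)=\prod_{i=0}^{k-1}(x-\alpha^{trq^i})$. Let $l=\min\{\nu_2(n/2),\nu_2(q+1)\}$. Then $d=2^l\gcd(n,q-1)$, the element $\beta=\theta^{2^l}$ is a primitive $\gcd(n,q-1)$-th root of unity, and $f(x^n)$ factors into irreducible polynomials in $\mathbb F_q[x]$ as $$f(x^n)=\prod_{\substack{t\mid m\\ t\ \text{odd}}}\ \prod_{\substack{1\le w\le\gcd(n,q-1)\\ \gcd(w,t)=1}}\beta^{-wk}g_t(\beta^wx^t)\ \prod_{t\mid m}\ \prod_{u\in R_t}\Bigl[\theta^{-uk(q+1)}g_t(\theta^ux^t)\,g_t(\theta^{uq}x^t)\Bigr],$$ where, for each $t\mid m$, $R_t$ is a set of representatives of the classes of the set $\{u\in\mathbb N: 1\le u\le d,\ \gcd(u,t)=1,\ 2^l\nmid u\}$ under the equivalence relation $u\sim_d u'$ iff $u\equiv u'q^j\pmod d$ for some $j\in\mathbb N$. Moreover, the total number of irreducible factors of $f(x^n)$ in $\mathbb F_q[x]$ is $$\gcd(n,q-1)\left(\frac12+2^{l-2}\bigl(2+\nu_2(m)\bigr)\right)\prod_{\substack{p\mid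 m\\ p\ \text{odd prime}}}\left(1+\nu_p(m)\frac{p-1}{p}\right).$$
   Context: $\nu_p$ denotes the $p$-adic valuation. The order of a polynomial $f$ with $f(0)\ne0$ is the least positive integer $e$ with $f(x)\mid x^e-1$.
   Formalization: The displayed factorization is false for non-monic f (e.g. q=3, n=8, f=2x−2), since its right-hand side is monic; the formal statement multiplies the right-hand side by the leading coefficient of f, which is 1 when f is monic. *)

(* Defs.v *)
From HB Require Import structures.
From mathcomp Require Import all_boot all_order all_algebra all_field.
Set Implicit Arguments.
Unset Strict Implicit.
Unset Printing Implicit Defensive.
Import Order.TTheory GRing.Theory Num.Theory.
Local Open Scope ring_scope.

Definition poly_has_order (F : fieldType) (f : {poly F}) (e : nat) : Prop :=
  [/\ f.[0] != 0, (0 < e)%N, f %| 'X^e - 1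
    & forall e' : nat, (0 < e')%N -> f %| 'X^e' - 1 -> (e <= e')%N].

(* A polynomial over the extension L has coefficients in F and is irreducible
   as an element of F[X]. *)
Definition irreducible_over (F : fieldType) (L : fieldExtType F)
    (P : {poly L}) : Prop :=
  exists2 p : {poly F}, irreducible_poly p & P = map_poly (in_alg L) p.

(* s lists, with multiplicity, the monic irreducible factors of p. *)
Definition irreducible_factorization (F : fieldType) (p : {poly F})
    (s : seq {poly F}) : Prop :=
  (forall h, h \in s -> h \is monic /\ irreducible_poly h)
  /\ p = lead_coef p *: \prod_(h <- s) h.

Definition q_equiv (q d u u' : nat) : Prop :=
  exists j : nat, u = (u' * q ^ j)%N %[mod d].

Definition index_set (d l t : nat) : {set 'I_d.+1} :=
  [set u : 'I_d.+1 | [&& (0 < u)%N, coprime u t & ~~ (2 ^ l %| u)%N]].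

Definition representatives (q d : nat) (S R : {set 'I_d.+1}) : Prop :=
  R \subset S /\
  forall u, u \in S -> exists! v : 'I_d.+1, v \in R /\ q_equiv q d u v.

Definition gpoly (L : fieldType) (q k r : nat) (alpha : L) (t : nat) :
    {poly L} :=
  \prod_(i < k) ('X - (alpha ^+ (t * r * q ^ i))%:P).

Definition factor1 (L : fieldType) (q k r : nat) (alpha beta : L)
    (t w : nat) : {poly L} :=
  beta ^- (w * k) *: (gpoly q k r alpha t \Po (beta ^+ w *: 'X^t)).

Definition factor2 (L : fieldType) (q k r : nat) (alpha theta : L)
    (t u : nat) : {poly L} :=
  theta ^- (u * k * (q + 1)) *:
    ((gpoly q k r alpha t \Po (theta ^+ u *: 'X^t))
     * (gpoly q k r alpha t \Po (theta ^+ (u * q) *: 'X^t))).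

(* Main.v *)
Require Import Defs.
From HB Require Import structures.
From mathcomp Require Import all_boot all_order all_algebra all_field.
From mathcomp Require Import zify ring.
Set Implicit Arguments.
Unset Strict Implicit.
Unset Printing Implicit Defensive.
Import Order.TTheory GRing.Theory Num.Theory.
Local Open Scope ring_scope.

(** Put a = alpha^r, so that a^n = alpha, and write Q for q or q^2.  A root y of
    f(X^n) is y = zeta * a^(q^i) with zeta^n = 1; the least t such that zeta^t
    is a power of theta divides n/d, and zeta^t = theta^(-u) with u coprime to t,
    which places y among the roots of one of the listed factors.  Conversely,
    let y be a root of a factor, with y^(q^j) = y.  Then k divides j, and the
    order of zeta^(Q-1) is exactly t, so t divides 1 + Q + ... + Q^(s-1) for
    Q^s = q^j, which forces t | s.  Hence y has as many conjugates as the degree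
    of the factor, which is therefore irreducible.  The product formula follows
    by comparing degrees, since f(X^n) is separable. *)

(** The obstacle is the prime 2. If an odd prime p divides Q - 1, the sum 1 + Q + ... + Q^(s-1) has
    the same p-adic valuation as s; for p = 2 this needs 4 | Q - 1, whereas q = 3 mod 4 makes q - 1
    twice an odd number. Hence Q = q serves odd t only, and even t call for Q = q^2. This matches
    the two families: theta^u lies in the base field exactly when 2^l | u, which for u coprime to t
    forces t odd. For the other u, the factor is the product of two polynomials over the quadratic
    extension that Frobenius exchanges. Disjointness of the listed factors is never checked
    directly. The roots of f(X^n) are simple and each is a root of some listed factor, so f(X^n)
    divides the product; the degrees agree by Gauss's sum of totients over the divisors of m;
    separability then shows that the factors are distinct. The number of factors comes from the same
    counts with phi(t)/t in place of phi(t), summed as an Euler product. *)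

(** * Geometric sums, valuations and counts of coprime residues *)

Section Arithmetic.
Local Open Scope nat_scope.

(** With Q = 1 + xp, Q^i = 1 + ixp mod p^2, so the sum is p + xp C(p,2), and p divides C(p,2) when p
    is odd. For p = 2 this binomial is 1, whence the extra condition modulo 4. The point is that p
    divides the sum exactly once. *)
Lemma geom_sum_modp2 p Q : prime p -> p %| Q - 1 -> 0 < Q ->
  (p = 2 -> 4 %| Q - 1) -> \sum_(i < p) Q ^ i = p %[mod p ^ 2].
Proof.
move=> pr_p /dvdnP[x Dx] Q_gt0 p2.
have DQ : Q = (x * p).+1 by rewrite -Dx subn1 prednK.
case: (eqVneq p 2) => [ep | np2].
  have /dvdnP[y Dy] := p2 ep.
  have DQ4 : Q = 1 + y * 4 by rewrite -Dy subnKC.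
  rewrite DQ4 ep !big_ord_recr big_ord0 /= add0n expn0 expn1 addnA.
  by rewrite (_ : 2 ^ 2 = 4) // addnC modnMDl.
have powQ i : Q ^ i = 1 + i * (x * p) %[mod p ^ 2].
  elim: i => [|i IH]; first by rewrite expn0 mul0n.
  rewrite expnS -modnMmr IH modnMmr DQ.
  have -> : (x * p).+1 * (1 + i * (x * p)) =
    i * x ^ 2 * p ^ 2 + (1 + i.+1 * (x * p)) by ring.
  by rewrite modnMDl.
have -> : \sum_(i < p) Q ^ i = \sum_(i < p) (1 + i * (x * p)) %[mod p ^ 2].
  rewrite -(big_mkord xpredT (fun i => Q ^ i)) -(big_mkord xpredT (fun i => 1 + i * (x * p))).
  elim: {1 3}p => [|K IH]; first by rewrite !big_nil.
  by rewrite !big_nat_recr //= -modnDm IH powQ modnDm.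
rewrite big_split /= sum_nat_const card_ord muln1 -big_distrl /=.
rewrite -(big_mkord xpredT id) bin2_sum.
have /dvdnP[c ->] : p %| 'C(p, 2).
  apply: prime_dvd_bin => //; have := prime_gt1 pr_p.
  by rewrite leq_eqVlt eq_sym (negPf np2).
have -> : p + c * p * (x * p) = c * x * p ^ 2 + p by ring.
by rewrite modnMDl.
Qed.

Lemma geom_sumM Q a b :
  \sum_(i < a * b) Q ^ i = (\sum_(i < a) Q ^ i) * (\sum_(j < b) (Q ^ a) ^ j).
Proof.
rewrite -!(big_mkord xpredT) mulnC.
elim: b => [|b IH]; first by rewrite mul0n !big_nil muln0.
rewrite [RHS]mulnC big_nat_recr //= mulnDl [_ * \sum_(0 <= i < a) _]mulnC -IH.
rewrite mulSn addnC (@big_cat_nat _ _ _ (b * a)) ?leq_addr //=.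
congr (_ + _); rewrite -{1}[b * a]add0n big_addn addKn big_distrr /=.
by apply: eq_bigr => i _; rewrite expnD mulnC -expnM [a * b]mulnC.
Qed.

(** Modulo p the sum is s, so s = p s'. The sum then splits into the sum of length p for Q, which
    contains p exactly once, and the sum of length s' for Q^p, to which the induction on a
    applies. *)
Lemma pfactor_dvdn_geom_sum p a Q s : prime p -> p %| Q - 1 -> 0 < Q ->
  (p = 2 -> 4 %| Q - 1) -> p ^ a %| \sum_(i < s) Q ^ i -> p ^ a %| s.
Proof.
move=> pr_p; elim: a Q s => [|a IH] Q s pQ Q_gt0 p2 dvS.
  by rewrite expn0 dvd1n.
have p_gt0 := prime_gt0 pr_p.
have Q1 : Q = 1 %[mod p] by apply/eqP; rewrite eqn_mod_dvd.
have sS : \sum_(i < s) Q ^ i = s %[mod p].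
  rewrite -(big_mkord xpredT (fun i => Q ^ i)).
  elim: {dvS} s => [|s IHs]; first by rewrite big_nil.
  rewrite big_nat_recr //= -modnDm IHs.
  by rewrite -modnXm Q1 modnXm exp1n modnDm addn1.
have /dvdnP[s' Ds] : p %| s.
  rewrite /dvdn -sS -/(dvdn _ _); apply: dvdn_trans dvS.
  by rewrite expnS dvdn_mulr.
have Qp1 z : z %| Q - 1 -> z %| Q ^ p - 1.
  move=> h; apply: dvdn_trans h _.
  by rewrite -{2}(exp1n p) subn_exp dvdn_mulr.
move: dvS; rewrite Ds [s' * p]mulnC geom_sumM expnS.
have hS := geom_sum_modp2 pr_p pQ Q_gt0 p2.
have pp2 : p %| p ^ 2 by rewrite expnS dvdn_mulr.
have /dvdnP[c Dc] : p %| \sum_(i < p) Q ^ i.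
  by rewrite /dvdn -(modn_dvdm _ pp2) hS modn_dvdm // modnn.
move: hS; rewrite Dc => hc.
rewrite [c * p]mulnC -mulnA !dvdn_pmul2l // Gauss_dvdr; last first.
  rewrite coprimeXl // prime_coprime //; apply/negP => /dvdnP[c' Dc'].
  move: hc; rewrite Dc' -mulnA mulnn modnMl => /eqP.
  rewrite eq_sym modn_small ?(gtn_eqF p_gt0) //.
  by rewrite -mulnn -{1}(muln1 p) ltn_pmul2l ?prime_gt1.
by apply: IH => [||/p2]; [apply: Qp1 | rewrite expn_gt0 Q_gt0 | apply: Qp1].
Qed.

Lemma dvdn_geom_sum t Q s : 0 < t -> 0 < Q ->
  (forall p, prime p -> p %| t -> p %| Q - 1) -> (2 %| t -> 4 %| Q - 1) ->
  t %| \sum_(i < s) Q ^ i -> t %| s.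
Proof.
move=> t_gt0 Q_gt0 hp h2 dvS; apply/dvdn_partP => // p pt.
move: pt; rewrite mem_primes => /and3P[pr_p _ pt].
rewrite p_part; apply: (@pfactor_dvdn_geom_sum _ _ Q) => //; first exact: hp.
  by move=> ep; apply: h2; rewrite -ep.
by apply: dvdn_trans dvS; rewrite -p_part dvdn_part.
Qed.

(** Valuations are compared prime by prime. At 2, q - 1 has valuation 1 and n one more than n/2, so
    both sides have valuation l + 1. An odd prime p dividing n divides q - 1, hence not q + 1, as
    the two differ by 2. *)
Lemma gcdn_sqr_pred q n : q = 3 %[mod 4] -> 0 < n -> 8 %| n ->
  (forall p, prime p -> p %| n -> p %| q - 1) ->
  let l := minn (logn 2 (n %/ 2)) (logn 2 (q + 1)) in
  gcdn n (q ^ 2 - 1) = 2 ^ l * gcdn n (q - 1) /\ 2 <= l.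
Proof.
move=> q4 n_gt0 n8 hp l.
have q_gt1 : 1 < q by lia.
have Dq2 : q ^ 2 - 1 = (q - 1) * (q + 1) by rewrite -subn_sqr exp1n.
have qp : 0 < q - 1 by lia.
have qp' : 0 < q + 1 by lia.
have v1 : logn 2 (q - 1) = 1.
  apply/eqP; rewrite eqn_leq -[1 <= _]pfactor_dvdn // leqNgt -pfactor_dvdn //.
  by apply/andP; split; lia.
have v2 : 2 <= logn 2 (q + 1) by rewrite -pfactor_dvdn //; lia.
have n2 : 2 %| n by apply: dvdn_trans n8.
have vn : logn 2 n = (logn 2 (n %/ 2)).+1.
  rewrite -{1}(divnK n2) lognM ?divn_gt0 ?(dvdn_leq _ n2) //.
  by rewrite (pfactorK 1) // addn1.
have vn3 : 3 <= logn 2 n by rewrite -pfactor_dvdn.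
split; last by rewrite leq_min v2 andbT; move: vn3; rewrite vn ltnS.
apply: eqn_from_log => [||p].
- by rewrite gcdn_gt0 n_gt0.
- by rewrite muln_gt0 expn_gt0 gcdn_gt0 n_gt0.
rewrite lognM ?expn_gt0 ?gcdn_gt0 ?n_gt0 // !logn_gcd //; last by rewrite Dq2 muln_gt0 qp qp'.
rewrite lognX Dq2 lognM //.
case: (eqVneq p 2) => [->|p2].
  by rewrite v1 vn (pfactorK 1) // muln1 /l; lia.
rewrite (logn_prime p (q := 2)) // (negPf p2) muln0 add0n.
case: (boolP (prime p)) => [pr_p|np]; last first.
  have l0 x : logn p x = 0 by rewrite lognE (negPf np).
  by rewrite !l0.
case: (boolP (p %| n)) => [pn|pn]; last first.
  by rewrite [logn p n]lognE (negPf pn) !andbF !min0n.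
rewrite [logn p (q + 1)]lognE; case: (boolP (p %| q + 1)) => [pq|]; last by rewrite !andbF addn0.
have /dvdn_sub/(_ (hp _ pr_p pn)) := pq.
by rewrite (_ : q + 1 - (q - 1) = 2) ?dvdn_prime2 ?(negPf p2) //; lia.
Qed.

Lemma sum_periodic (P : nat -> nat) a b : (forall u, P (u + a) = P u) ->
  \sum_(0 <= u < b * a) P u = b * \sum_(0 <= u < a) P u.
Proof.
move=> perP; have perb c u : P (u + c * a) = P u.
  by elim: c => [|c IH]; rewrite ?addn0 // mulSn addnCA addnC perP.
elim: b => [|b IH]; first by rewrite !mul0n big_nil.
rewrite mulSn addnC (@big_cat_nat _ _ _ (b * a)) ?leq_addr //= IH mulSn addnC.
congr (_ + _); rewrite -{1}[b * a]add0n big_addn addKn.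
by apply: eq_bigr => i _.
Qed.

Lemma coprime_primes t u : 0 < t ->
  coprime u t = all (fun p => ~~ (p %| u)) (primes t).
Proof.
move=> t_gt0; apply/idP/allP => [cop p | h].
  rewrite mem_primes => /and3P[pr_p _ pt]; apply: contraL cop => pu.
  by apply/negP => /(coprime_dvdl pu)/(coprime_dvdr pt); rewrite /coprime gcdnn => /eqP ep; rewrite ep in pr_p.
rewrite /coprime; case: (posnP u) => [u0|u_gt0].
  rewrite u0 gcd0n; case: (leqP t 1) => [|t_gt1]; first by lia.
  have /h : pdiv t \in primes t by rewrite mem_primes pdiv_prime // t_gt0 pdiv_dvd.
  by rewrite u0 dvdn0.
apply/negPn/negP => ng; have g1 : 1 < gcdn u t.
  by rewrite ltn_neqAle eq_sym ng gcdn_gt0 u_gt0.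
have := pdiv_dvd (gcdn u t); rewrite dvdn_gcd => /andP[pu pt].
by have /h : pdiv (gcdn u t) \in primes t; rewrite ?pu // mem_primes pdiv_prime // t_gt0.
Qed.

Lemma coprimeDr_rad a t u : 0 < t -> (forall p, prime p -> p %| t -> p %| a) ->
  coprime (u + a) t = coprime u t.
Proof.
move=> t_gt0 h; rewrite !coprime_primes //; apply: eq_in_all => p.
by rewrite mem_primes => /and3P[pr_p _ /h pa]; rewrite dvdn_addl ?pa.
Qed.

Lemma coprime_mod_rad a t u v : 0 < t -> (forall p, prime p -> p %| t -> p %| a) ->
  u = v %[mod a] -> coprime u t = coprime v t.
Proof.
move=> t_gt0 h uv; rewrite !coprime_primes //; apply: eq_in_all => p.
rewrite mem_primes => /and3P[pr_p _ pt].
by have pa := h _ pr_p pt; rewrite /dvdn -(modn_dvdm u pa) uv modn_dvdm.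
Qed.

(** Coprimality to t is periodic in u with period t, and also with period a, since every prime of t
    divides a. Both sides count the u below a t that are coprime to t. *)
Lemma count_coprime a t : 0 < t -> (forall p, prime p -> p %| t -> p %| a) ->
  t * \sum_(1 <= u < a.+1 | coprime u t) 1 = a * totient t.
Proof.
move=> t_gt0 h; rewrite big_mkcond /=.
pose P u := if coprime u t then 1 else 0.
have perP u : P (u + a) = P u by rewrite /P coprimeDr_rad.
have perPt u : P (u + t) = P u by rewrite /P coprimeDr_rad // => p.
have -> : \sum_(1 <= u < a.+1) P u = \sum_(0 <= u < a) P u.
  case: a {h} perP => [|a] perP; first by rewrite !big_nil.
  rewrite big_nat_recr //= [RHS]big_nat_recl //= addnC.
  by rewrite big_add1 -(perP 0).
rewrite -(sum_periodic t perP) mulnC (sum_periodic a perPt) totient_count_coprime.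
congr (_ * _); apply: eq_bigr => u _; rewrite /P coprime_sym.
by case: coprime.
Qed.

End Arithmetic.

(** * Classes of indices under multiplication by q modulo d *)

Section Representatives.
Local Open Scope nat_scope.
Variables (q d l t : nat) (R : {set 'I_d.+1}).
Hypotheses (t_gt0 : 0 < t) (rad_t : forall p, prime p -> p %| t -> p %| d).
Hypotheses (q2 : q ^ 2 = 1 %[mod d]) (l_dvd : 2 ^ l %| d).
Hypothesis q_gt0 : 0 < q.
Hypothesis nfix : forall u, d %| u * (q - 1) -> 2 ^ l %| u.
Local Notation S := (index_set d l t).
Hypothesis repR : representatives q S R.

Lemma q_equiv2 u v : q_equiv q d u v ->
  u = v %[mod d] \/ u = v * q %[mod d].
Proof.
case=> j ->.
have q2s s : q ^ (2 * s) = 1 %[mod d].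
  by rewrite expnM -modnXm q2 modnXm exp1n.
rewrite -(odd_double_half j) -mul2n expnD.
rewrite mulnA -modnMmr q2s modnMmr muln1.
by case: (odd j); [right; rewrite expn1 | left; rewrite expn0 muln1].
Qed.

Lemma index_setP (u : 'I_d.+1) : u \in S ->
  [/\ 0 < u, u < d, coprime u t & ~~ (2 ^ l %| u)].
Proof.
rewrite inE => /and3P[u_gt0 ut lu]; split=> //.
rewrite ltn_neqAle -[_ <= _]ltnS ltn_ord andbT.
by apply: contraNneq lu => ->.
Qed.

(** The Frobenius action on exponents of theta. The indices of [S] lie strictly between 0 and d,
    because 2^l | d excludes u = d, so reduction modulo d loses nothing there. As q^2 = 1 mod d, the
    map is an involution on [S]. *)
Definition conj_index (u : 'I_d.+1) : 'I_d.+1 := inord ((u * q) %% d).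

Lemma val_conj_index (u : 'I_d.+1) : u \in S -> conj_index u = (u * q) %% d :> nat.
Proof.
case/index_setP=> u_gt0 u_d _ _; rewrite inordK // ltnS ltnW // ltn_mod.
exact: leq_ltn_trans u_d.
Qed.

Lemma index_inj (u v : 'I_d.+1) : u \in S -> v \in S -> u = v %[mod d] -> u = v.
Proof.
move=> /index_setP[_ ud _ _] /index_setP[_ vd _ _].
by rewrite !modn_small // => /val_inj.
Qed.

Lemma coprime_q : coprime q (2 ^ l).
Proof.
have : coprime (q ^ 2) (2 ^ l).
  rewrite -coprime_modl -(modn_dvdm _ l_dvd) q2 modn_dvdm // coprime_modl.
  exact: coprime1n.
by rewrite coprime_pexpl.
Qed.

Lemma conj_index_in (u : 'I_d.+1) : u \in S -> conj_index u \in S.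
Proof.
move=> uS; have [u_gt0 u_d ut lu] := index_setP uS.
have lu' : ~~ (2 ^ l %| (u * q) %% d).
  by rewrite /dvdn modn_dvdm // -/(dvdn _ _) Gauss_dvdl // coprime_sym coprime_q.
rewrite inE val_conj_index // lu' andbT lt0n; apply/andP; split.
  by apply: contraNneq lu' => ->.
rewrite (@coprime_mod_rad d t _ (u * q)) ?modn_mod // coprimeMl ut.
have : coprime (q ^ 2) t.
  by rewrite (coprime_mod_rad t_gt0 rad_t q2) coprime1n.
by rewrite coprime_pexpl.
Qed.

Lemma conj_indexK (u : 'I_d.+1) : u \in S -> conj_index (conj_index u) = u.
Proof.
move=> uS; have cuS := conj_index_in uS.
apply: (index_inj (conj_index_in cuS) uS).
rewrite !val_conj_index // modn_mod modnMml.
by rewrite -mulnA mulnn -modnMmr q2 modnMmr muln1.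
Qed.

(** Each class is a pair {u, uq mod d}, so [S] is the union of [R] and its image under [conj_index].
    The union is disjoint because a fixed u would satisfy d | u(q - 1), hence 2^l | u by [nfix]. *)
Lemma card_index_set : #|S| = 2 * #|R|.
Proof.
have [RS repr] := repR; have RSP := subsetP RS.
have -> : S = R :|: conj_index @: R.
  apply/setP => u; rewrite in_setU; apply/idP/orP => [uS|[/RSP//|]]; last first.
    by case/imsetP=> v /RSP vS ->; apply: conj_index_in.
  have [v [[vR /q_equiv2[] uv] _]] := repr u uS.
    by left; rewrite (index_inj uS (RSP _ vR) uv).
  right; apply/imsetP; exists v => //; have vS := RSP _ vR.
  by apply: (index_inj uS (conj_index_in vS)); rewrite val_conj_index // modn_mod.
rewrite cardsU (_ : R :&: _ = set0); last first.
  apply/setP => u; rewrite !inE; apply/negP => /andP[uR /imsetP[v vR Du]].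
  have vS := RSP _ vR.
  (* Both u and v represent the class of u, so they coincide and u is fixed. *)
  have [w [_ uniqw]] := repr u (RSP _ uR).
  have wv : w = v.
    apply: uniqw; split=> //; exists 1.
    by rewrite expn1 Du val_conj_index // modn_mod.
  have wu : w = u by apply: uniqw; split=> //; exists 0; rewrite muln1.
  have [_ _ _ /negP[]] := index_setP vS.
  apply: nfix; rewrite mulnBr muln1 -eqn_mod_dvd ?leq_pmulr //.
  by rewrite -(modn_mod (v * q)) -val_conj_index // -Du -wu wv.
rewrite cards0 subn0 card_in_imset ?mul2n ?addnn // => u v uR vR /(congr1 conj_index).
by rewrite !conj_indexK ?RSP.
Qed.

End Representatives.

(** * Euler products for sums over divisors *)

Section DivisorSum.
Variables (h : nat -> rat).
Hypotheses (h1 : h 1 = 1) (hM : forall a b, coprime a b -> h (a * b)%N = h a * h b).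

Lemma divisors_pfactorM p a m : prime p -> (0 < m)%N -> ~~ (p %| m)%N ->
  perm_eq (divisors (p ^ a * m)) [seq (p ^ i * t)%N | i <- iota 0 a.+1, t <- divisors m].
Proof.
move=> pr_p m_gt0 pm.
have p_gt0 := prime_gt0 pr_p.
have lg i t : (t %| m)%N -> logn p (p ^ i * t)%N = i.
  move=> tm; rewrite mulnC logn_Gauss ?pfactorK // prime_coprime //.
  by apply: contra pm => /dvdn_trans->.
apply: uniq_perm; rewrite ?divisors_uniq //.
  apply: allpairs_uniq; rewrite ?iota_uniq ?divisors_uniq //.
  move=> [i t] [j s] it js /= E.
  have tm : t \in divisors m by case/allpairsP: it => -[? ?] [_ /= ? [_ ->]].
  have sm : s \in divisors m by case/allpairsP: js => -[? ?] [_ /= ? [_ ->]].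
  rewrite -!dvdn_divisors // in tm sm.
  have ij : i = j by rewrite -(lg i t) // E lg.
  by move/eqP: E; rewrite ij eqn_pmul2l ?expn_gt0 ?p_gt0 // => /eqP->.
move=> x; rewrite -dvdn_divisors ?muln_gt0 ?expn_gt0 ?p_gt0 //.
apply/idP/allpairsP => [xd | [[i t] [ia /= tm ->]]]; last first.
  rewrite mem_iota ltnS /= in ia; rewrite -dvdn_divisors // in tm.
  by rewrite dvdn_mul // dvdn_exp2l.
have pm_gt0 : (0 < p ^ a * m)%N by rewrite muln_gt0 expn_gt0 p_gt0.
have x_gt0 : (0 < x)%N by apply: dvdn_gt0 xd.
have [t cpt Dx] := pfactor_coprime pr_p x_gt0.
exists (logn p x, t); split; last by rewrite {1}Dx mulnC.
  by rewrite mem_iota ltnS /= -(lg a m) // dvdn_leq_log.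
rewrite -dvdn_divisors //= -(@Gauss_dvdr _ (p ^ a)) ?coprimeXr 1?coprime_sym //.
by apply: dvdn_trans xd; rewrite Dx dvdn_mulr.
Qed.

(** Strong induction on m, splitting off the full power of its smallest prime: the divisors of p^a
    m' are the products p^i t with i at most a and t | m', and multiplicativity factors the sum. *)
Lemma sum_divisors m : (0 < m)%N ->
  \sum_(t <- divisors m) h t =
  \prod_(p <- primes m) \sum_(0 <= i < (logn p m).+1) h (p ^ i)%N.
Proof.
elim/ltn_ind: m => m IH m_gt0.
case: (leqP m 1) => [|m_gt1].
  case: m m_gt0 {IH} => [|[|]] // _ _.
  by rewrite /= big_nil big_seq1.
pose p := pdiv m; have pr_p : prime p by apply: pdiv_prime.
have p_gt0 := prime_gt0 pr_p.
have [m' cpm Dm] := pfactor_coprime pr_p m_gt0.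
have a_gt0 : (0 < logn p m)%N by rewrite -pfactor_dvdn // pdiv_dvd.
move: (logn p m) a_gt0 Dm => a a_gt0 Dm.
have pm : ~~ (p %| m')%N by rewrite -prime_coprime.
have m'_gt0 : (0 < m')%N by move: m_gt0; rewrite Dm muln_gt0 => /andP[].
have pa_gt0 : (0 < p ^ a)%N by rewrite expn_gt0 p_gt0.
have lta : (m' < m)%N by rewrite Dm ltn_Pmulr ?m'_gt0 -?(expn0 p) ?ltn_exp2l ?prime_gt1.
have perm_primes : perm_eq (primes m) (p :: primes m').
  apply: uniq_perm; rewrite ?primes_uniq //= ?primes_uniq ?andbT.
    by rewrite mem_primes pr_p m'_gt0.
  by move=> x; rewrite Dm mulnC primesM // primesX // primes_prime // !inE.
rewrite (perm_big _ perm_primes) big_cons /=.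
have -> : logn p m = a by rewrite Dm logn_Gauss ?pfactorK //.
have -> : \prod_(r <- primes m') \sum_(0 <= i < (logn r m).+1) h (r ^ i)%N
  = \prod_(r <- primes m') \sum_(0 <= i < (logn r m').+1) h (r ^ i)%N.
  apply: eq_big_seq => r; rewrite mem_primes => /and3P[pr_r _ rm].
  rewrite Dm mulnC logn_Gauss // coprimeXr // prime_coprime // dvdn_prime2 //.
  by apply: contraNneq pm => <-.
rewrite -IH // {1}Dm mulnC (perm_big _ (divisors_pfactorM a pr_p m'_gt0 pm)).
rewrite big_allpairs_dep mulr_suml; apply: eq_bigr => i _.
rewrite mulr_sumr; apply: eq_big_seq => t; rewrite -dvdn_divisors // => tm.
by rewrite hM // coprimeXl // (coprime_dvdr tm).
Qed.

End DivisorSum.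

(** The flag [b] treats all divisors and odd divisors at once; putting the parity test inside [h]
    keeps it multiplicative. The local factor is linear in the valuation because phi(p^i)/p^i = (p -
    1)/p for every i > 0. *)
Lemma sum_totient_divisors (b : bool) m : (0 < m)%N ->
  \sum_(t <- divisors m | b || odd t) (totient t)%:R / t%:R =
  \prod_(p <- primes m | b || odd p) (1 + (logn p m)%:R * ((p%:R - 1) / p%:R)) :> rat.
Proof.
move=> m_gt0; pose h t : rat := if b || odd t then (totient t)%:R / t%:R else 0.
have h1 : h 1%N = 1 by rewrite /h orbT divr1.
have hM x y : coprime x y -> h (x * y)%N = h x * h y.
  move=> cxy; rewrite /h oddM totient_coprime // !natrM invfM.
  by case: (b); case: (odd x); case: (odd y); rewrite /= ?mul0r ?mulr0 // mulrACA.
rewrite big_mkcond (sum_divisors h1 hM m_gt0) [RHS]big_mkcond /=.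
apply: eq_big_seq => p; rewrite mem_primes => /and3P[pr_p _ _].
rewrite big_nat_recl // h1; set v := logn p m.
have p0 : p%:R != 0 :> rat by rewrite pnatr_eq0 -lt0n prime_gt0.
have hp i : h (p ^ i.+1)%N = if b || odd p then (p%:R - 1) / p%:R else 0.
  rewrite /h oddX /=; case: ifP => // _.
  rewrite totient_pfactor // natrM expnS natrM -subn1 natrB ?prime_gt0 //.
  by rewrite -mulf_div divff ?mulr1 // pnatr_eq0 -lt0n expn_gt0 prime_gt0.
under eq_bigr do rewrite hp.
rewrite sumr_const_nat subn0; case: ifP => _; last by rewrite mul0rn addr0.
by rewrite mulr_natl.
Qed.

(** * Total degree and number of the factors *)

Section Counting.
Local Open Scope nat_scope.

Definition coprime_count a t := \sum_(1 <= u < a.+1 | coprime u t) 1.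

Lemma sum_multiples a b (P : pred nat) : 0 < a ->
  \sum_(1 <= u < (a * b).+1 | (a %| u) && P u) 1 =
  \sum_(1 <= w < b.+1 | P (a * w)) 1.
Proof.
move=> a_gt0; rewrite -big_filter_cond.
rewrite (perm_big [seq a * w | w <- index_iota 1 b.+1]) ?big_map //.
apply: uniq_perm; first by rewrite filter_uniq // iota_uniq.
  rewrite map_inj_uniq ?iota_uniq // => x y /eqP.
  by rewrite eqn_pmul2l // => /eqP.
move=> x; rewrite mem_filter mem_index_iota ltnS; apply/andP/mapP.
  case=> /dvdnP[w ->] h; exists w; last by rewrite mulnC.
  move: h; rewrite mulnC muln_gt0 a_gt0 leq_pmul2l // => /andP[/= w_gt0 wb].
  by rewrite mem_index_iota w_gt0.
case=> w; rewrite mem_index_iota ltnS => /andP[w_gt0 wb] ->.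
by rewrite dvdn_mulr // muln_gt0 a_gt0 w_gt0 leq_pmul2l.
Qed.

Lemma card_index_set_sum d l t :
  #|index_set d l t| = \sum_(1 <= u < d.+1 | coprime u t && ~~ (2 ^ l %| u)) 1.
Proof.
rewrite -sum1_card; under eq_bigl do rewrite inE.
rewrite -(big_mkord (fun u => [&& 0 < u, coprime u t & ~~ (2 ^ l %| u)]) (fun=> 1)).
rewrite big_ltn_cond // ltnn /= big_nat_cond [RHS]big_nat_cond.
by apply: eq_bigl => -[|u].
Qed.

(** The indices missing from the set are the multiples 2^l w. They can be coprime to t only for odd
    t, and then w runs over the integers from 1 to G coprime to t. *)
Lemma card_index_setE l G t : 0 < l ->
  #|index_set (2 ^ l * G) l t| + (if odd t then coprime_count G t else 0)
  = coprime_count (2 ^ l * G) t.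
Proof.
move=> l_gt0; set d := 2 ^ l * G.
rewrite card_index_set_sum.
rewrite /coprime_count [RHS](bigID (fun u => 2 ^ l %| u)) /= addnC; congr (_ + _).
rewrite [RHS](eq_bigl (fun u => (2 ^ l %| u) && coprime u t)); last first.
  by move=> u; rewrite andbC.
rewrite sum_multiples ?expn_gt0 //; case: ifP => [odd_t | even_t].
  by apply: eq_bigl => w; rewrite coprimeMl coprimeXl // coprime2n.
rewrite big_pred0 // => w; rewrite coprimeMl coprime_pexpl // coprime2n.
by rewrite even_t.
Qed.

Lemma sum_totient_divisors_nat m : 0 < m -> \sum_(t <- divisors m) totient t = m.
Proof.
move=> m_gt0; rewrite -[RHS]cyclic.sum_totient_dvd.
rewrite -(big_mkord (fun t => t %| m) totient) -[RHS]big_filter.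
apply/perm_big/uniq_perm; rewrite ?divisors_uniq ?filter_uniq ?iota_uniq // => t.
rewrite -dvdn_divisors // mem_filter mem_index_iota ltnS leq0n /=.
by case: (boolP (t %| m)) => // /(dvdn_leq m_gt0).
Qed.

Section Totals.
Variables (l G m : nat) (r : nat -> nat).
Hypotheses (l_gt1 : 2 <= l) (m_gt0 : 0 < m).
Hypothesis rad_m : forall p, prime p -> p %| m -> p %| G.
Hypothesis card_r : forall t, t %| m -> #|index_set (2 ^ l * G) l t| = 2 * r t.
Local Notation d := (2 ^ l * G).

Lemma coprime_count_split t : t %| m ->
  2 * r t + (if odd t then coprime_count G t else 0) = coprime_count d t.
Proof. by move=> tm; rewrite -card_r // card_index_setE // ltnW. Qed.

Lemma coprime_count_G t : t %| m -> t * coprime_count G t = G * totient t.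
Proof.
move=> tm; rewrite count_coprime ?(dvdn_gt0 m_gt0) // => p pr_p pt.
by apply: rad_m => //; apply: dvdn_trans tm.
Qed.

Lemma coprime_count_d t : t %| m -> t * coprime_count d t = d * totient t.
Proof.
move=> tm; rewrite count_coprime ?(dvdn_gt0 m_gt0) // => p pr_p pt.
by apply/dvdn_mull/rad_m => //; apply: dvdn_trans tm.
Qed.

(** Degrees divided by k: a factor of the first family counts t, one of the second 2t. For fixed t
    they add up to t times the number of u up to d coprime to t, which is d phi(t), and the phi(t)
    sum to m. *)
Lemma total_degree :
  \sum_(t <- divisors m | odd t) t * coprime_count G t +
  \sum_(t <- divisors m) 2 * t * r t = d * m.
Proof.
rewrite -[in RHS](sum_totient_divisors_nat m_gt0) big_distrr /= big_mkcond /=.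
rewrite -big_split /=; apply: eq_big_seq => t; rewrite -dvdn_divisors // => tm.
rewrite -coprime_count_d // -coprime_count_split // mulnDr addnC mulnCA mulnA.
by case: odd; rewrite ?muln0.
Qed.

Local Open Scope ring_scope.

(** Let A be the size of the first family and B the number of all pairs (t, u) with u coprime to t.
    The second family has (B - A)/2 members, so the total is (A + B)/2. Here A is G times the Euler
    product over odd primes, and B is d times the Euler product over all primes. *)
Lemma total_count :
  (\sum_(t <- divisors m | odd t) coprime_count G t + \sum_(t <- divisors m) r t)%N%:R =
  G%:R * (1 / 2 + 2 ^ (l%:Z - 2) * (2 + (logn 2 m)%:R))
  * \prod_(p <- primes m | odd p) (1 + (logn p m)%:R * ((p%:R - 1) / p%:R)) :> rat.
Proof.
set P := \prod_(p <- _ | _) _.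
have ratio a b c t : (t %| m)%N -> (t * a = b * c)%N -> a%:R = b%:R * (c%:R / t%:R) :> rat.
  move=> tm E; have t0 : t%:R != 0 :> rat by rewrite pnatr_eq0 -lt0n (dvdn_gt0 m_gt0).
  by rewrite mulrA -natrM -E natrM mulrC mulKf.
have EM : (\sum_(t <- divisors m | odd t) coprime_count G t)%N%:R = G%:R * P.
  rewrite /P -(sum_totient_divisors false m_gt0) /= natr_sum mulr_sumr.
  rewrite [LHS]big_seq_cond [RHS]big_seq_cond.
  apply: eq_bigr => t /andP[]; rewrite -dvdn_divisors // => tm _.
  exact/ratio/coprime_count_G.
have EN : (\sum_(t <- divisors m) coprime_count d t)%N%:R =
    d%:R * (1 + (logn 2 m)%:R / 2) * P.
  rewrite natr_sum.
  have -> : \sum_(t <- divisors m) (coprime_count d t)%:R =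
     d%:R * \sum_(t <- divisors m) ((totient t)%:R / t%:R) :> rat.
    rewrite mulr_sumr; apply: eq_big_seq => t; rewrite -dvdn_divisors // => tm.
    exact/ratio/coprime_count_d.
  (* The remaining local factor is that of 2. It equals 1 + [logn 2 m] / 2 for odd m too, the
     valuation being 0 then. *)
  rewrite (sum_totient_divisors true m_gt0) /= (bigID odd) /= -/P -mulrA [_ * P]mulrC.
  congr (_ * (_ * _)); rewrite big_seq_cond (eq_bigl (fun p => (p \in primes m) && (p == 2%N))).
    rewrite -big_seq_cond; case: (boolP (2%N \in primes m)) => m2.
      by rewrite -big_filter filter_pred1_uniq ?primes_uniq // big_seq1; congr (1 + _ * _).
    rewrite big1_seq => [|p /andP[/eqP-> pm]]; last by rewrite pm in m2.
    by move: m2; rewrite -logn_gt0 -eqn0Ngt => /eqP->; rewrite mul0r addr0.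
  move=> p; case: (boolP (p \in primes m)) => //=.
  rewrite mem_primes => /and3P[pr_p _ _].
  by case: (even_prime pr_p) => [->|odd_p] //; rewrite odd_p; case: eqP odd_p => // ->.
have EP : (2 * \sum_(t <- divisors m) r t + \sum_(t <- divisors m | odd t) coprime_count G t =
    \sum_(t <- divisors m) coprime_count d t)%N.
  rewrite big_distrr /= [X in (_ + X)%N]big_mkcond -big_split /=.
  by apply: eq_big_seq => t; rewrite -dvdn_divisors // => /coprime_count_split.
move/(congr1 (fun x => x%:R : rat)): EP; rewrite natrD natrM EM EN => E.
rewrite natrD EM.
(* The exponent l - 2 is an integer; l >= 2 turns it into a natural number. *)
have d2 : d%:R = 4 * 2 ^ (l%:Z - 2) * G%:R :> rat.
  have -> : l%:Z - 2 = (l - 2)%N by rewrite -subzn.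
  rewrite -{1}(subnKC l_gt1) expnD !natrM natrX.
  by congr (_ * _ * _); rewrite natrX.
have -> : (\sum_(t <- divisors m) r t)%N%:R = (d%:R * (1 + (logn 2 m)%:R / 2) * P - G%:R * P) / 2 :> rat.
  by rewrite -E addrK mulrC mulKf.
by rewrite d2; field.
Qed.
End Totals.
End Counting.

(** * Frobenius powers and descent to the finite base field *)

(** The proof [hN] is an argument so that the ring morphism structure, valid only for such
    exponents, can be attached to the function. *)
Definition expf_pchar (K : fieldType) N (hN : [pchar K].-nat N) (x : K) := x ^+ N.

Section FrobeniusPower.
Variables (K : fieldType) (N : nat) (hN : [pchar K].-nat N).

Fact expf_pchar_is_additive : zmod_morphism (expf_pchar hN).
Proof. by move=> x y; rewrite /expf_pchar exprDn_pchar // exprNn_pchar. Qed.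

Fact expf_pchar_is_monoid : monoid_morphism (expf_pchar hN).
Proof. by split=> [|x y]; rewrite /expf_pchar ?expr1n ?exprMn. Qed.

HB.instance Definition _ :=
  GRing.isZmodMorphism.Build K K (expf_pchar hN) expf_pchar_is_additive.
HB.instance Definition _ :=
  GRing.isMonoidMorphism.Build K K (expf_pchar hN) expf_pchar_is_monoid.

Lemma expf_pchar_inj : injective (fun x : K => x ^+ N).
Proof. exact: (fmorph_inj (expf_pchar hN)). Qed.

End FrobeniusPower.

Section FiniteBase.
Variables (F : finFieldType) (K : fieldType) (phi : {rmorphism F -> K}).
Local Notation q := #|F|.

Lemma finField_card_gt0 : (0 < q)%N.
Proof. by apply/card_gt0P; exists 0. Qed.

Lemma pchar_nat_card : [pchar K].-nat q.
Proof.
have [p pr_p pF] := finPcharP F.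
have /(pi_pnat (n := q)) := rmorph_pchar phi pF; apply.
have := pprimeChar_pgroup pF.
by rewrite /pgroup.pgroup cardsT.
Qed.

Lemma pchar_nat_cardX j : [pchar K].-nat (q ^ j)%N.
Proof. by rewrite pnatX pchar_nat_card. Qed.

Lemma root_expf_card (h : {poly F}) y j :
  root (map_poly phi h) y -> root (map_poly phi h) (y ^+ (q ^ j)).
Proof.
move=> ry; elim: j => [|j]; first by rewrite expn0.
rewrite expnSr exprM; move: (y ^+ _) => {ry}z rz.
have -> : map_poly phi h = map_poly (expf_pchar pchar_nat_card) (map_poly phi h).
  apply/polyP => i; rewrite !coef_map /=.
  by rewrite /expf_pchar -rmorphXn expf_card.
by rewrite -[z ^+ q]/(expf_pchar pchar_nat_card z) fmorph_root.
Qed.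

Lemma expf_card_period (y : K) i j : y ^+ (q ^ i) = y ^+ (q ^ j) -> (i <= j)%N ->
  y ^+ (q ^ (j - i)) = y.
Proof.
move=> E ij; apply: (expf_pchar_inj (pchar_nat_cardX i)) => /=.
by rewrite -exprM -expnD subnK.
Qed.

Lemma uniq_conjugates (y : K) s :
  (forall j, (0 < j < s)%N -> y ^+ (q ^ j) <> y) ->
  uniq [seq y ^+ (q ^ j) | j <- iota 0 s].
Proof.
move=> h; rewrite map_inj_in_uniq ?iota_uniq // => i j.
rewrite !mem_iota !add0n /= => i_s j_s E; apply/eqP.
wlog ij: i j i_s j_s E / (i <= j)%N.
  by case: (leqP i j) => [|/ltnW] ij H; [apply: H | rewrite eq_sym; apply: H].
rewrite eqn_leq ij /= -subn_eq0 -leqn0 leqNgt; apply/negP => ji.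
apply: (h (j - i)%N); last exact: expf_card_period.
by rewrite ji (leq_ltn_trans (leq_subr _ _)).
Qed.

(** An element fixed by the q-th power is a root of X^q - X, which splits over [F], so it comes from
    [F]. The map [g] inverts [phi] on the image; its default 0 concerns only elements outside it. *)
Lemma descend_poly (P : {poly K}) :
  (forall i, P`_i ^+ q = P`_i) -> exists p : {poly F}, P = map_poly phi p.
Proof.
move=> hP; pose g x := odflt 0 [pick a | phi a == x].
have phiK x : x ^+ q = x -> phi (g x) = x.
  move=> xq; rewrite /g; case: pickP => [a /eqP // | no_a].
  have : root (map_poly phi ('X^q - 'X)) x.
    by rewrite rmorphB /= map_polyXn map_polyX /root !hornerE xq subrr.
  rewrite finField_genPoly rmorph_prod /= /root horner_prod.
  case/prodf_eq0=> a _; rewrite map_polyXsubC !hornerE subr_eq0 => /eqP xa.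
  by have := no_a a; rewrite xa eqxx.
have g0 : g 0 = 0 by apply: (fmorph_inj phi); rewrite phiK ?rmorph0 // expr0n -(prednK finField_card_gt0).
exists (map_poly g P); apply/polyP => i.
by rewrite coef_map /= coef_map_id0 // phiK.
Qed.

End FiniteBase.

(** * Conjugates, irreducibility and Frobenius periods *)

Section Irreducibility.
Variables (F : finFieldType) (K : closedFieldType) (phi : {rmorphism F -> K}).
Local Notation q := #|F|.

(* Every divisor of P has a root, hence as many roots as that root has conjugates. *)
Lemma irreducible_conjugates (P : {poly F}) s : size P = s.+1 -> (0 < s)%N ->
  (forall y j, root (map_poly phi P) y -> y ^+ (q ^ j) = y -> (s %| j)%N) ->
  irreducible_poly P.
Proof.
move=> szP s_gt0 per; split=> [|h szh hP]; first by rewrite szP ltnS.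
have P0 : P != 0 by rewrite -size_poly_gt0 szP.
have h0 : h != 0 by apply: contraTneq hP => ->; rewrite dvd0p.
have /closed_rootP[y ry] : size (map_poly phi h) != 1 by rewrite size_map_poly.
have ryP : root (map_poly phi P) y.
  by apply: (root_dvdp _ ry); rewrite dvdp_map.
rewrite -dvdp_size_eqp // eqn_leq dvdp_leq //= szP.
rewrite -[s](size_iota 0) -(size_map (fun j => y ^+ (q ^ j))) -(size_map_poly phi).
apply: max_poly_roots; first by rewrite map_poly_eq0.
  by apply/allP => _ /mapP[j _ ->]; apply: root_expf_card.
apply: (uniq_conjugates phi) => j /andP[j_gt0 js] /(per _ _ ryP)/(dvdn_leq j_gt0).
by rewrite leqNgt js.
Qed.

End Irreducibility.

Lemma prod_cyclic_shift (R : comNzRingType) k (H : nat -> R) : H k = H 0%N ->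
  \prod_(i < k) H i.+1 = \prod_(i < k) H i.
Proof.
case: k => [|k] Hk; first by rewrite !big_ord0.
by rewrite big_ord_recr /= Hk mulrC [RHS]big_ord_recl.
Qed.

Section Conjugates.
Variables (F : finFieldType) (K : fieldType) (phi : {rmorphism F -> K}).
Local Notation q := #|F|.
Variables (f : {poly F}) (k : nat) (alpha : K).
Hypotheses (irr_f : irreducible_poly f) (sz_f : size f = k.+1).
Hypothesis root_f : root (map_poly phi f) alpha.

(** Let j0 be the least period of alpha. The product over its j0 conjugates is invariant under
    Frobenius, so it descends to some p over [F]; f divides p since they share a root, giving k <=
    j0. The j0 distinct conjugates are roots of f, giving j0 <= k. *)
Lemma irreducible_root_conjugates :
  [/\ map_poly phi f = phi (lead_coef f) *: \prod_(i < k) ('X - (alpha ^+ (q ^ i))%:P),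
    alpha ^+ (q ^ k) = alpha
  & forall j, alpha ^+ (q ^ j) = alpha -> (k %| j)%N].
Proof.
have f0 : f != 0 by rewrite -size_poly_gt0 sz_f.
have ex_per : exists j, (0 < j)%N && (alpha ^+ (q ^ j) == alpha).
  have [/hasP[j]|/hasPn no_j] := boolP (has (fun j => alpha ^+ (q ^ j) == alpha) (iota 1 k)).
    by rewrite mem_iota => /andP[j_gt0 _] aj; exists j; rewrite j_gt0.
  (* Without a period up to k, f of degree k would have k + 1 distinct roots. *)
  have : (size [seq alpha ^+ (q ^ j) | j <- iota 0 k.+1] < size (map_poly phi f))%N.
    apply: max_poly_roots; first by rewrite map_poly_eq0.
      by apply/allP => _ /mapP[j _ ->]; apply: root_expf_card.
    apply: (uniq_conjugates phi) => j hj; apply/eqP/no_j.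
    by rewrite mem_iota add1n.
  by rewrite size_map size_iota size_map_poly sz_f ltnn.
case: (ex_minnP ex_per) => j0 /andP[j0_gt0 /eqP aj0] min_j0.
pose h := \prod_(i < j0) ('X - (alpha ^+ (q ^ i))%:P).
have [p Dp] : exists p, h = map_poly phi p.
  apply: descend_poly => i.
  have Eh : map_poly (expf_pchar (pchar_nat_card phi)) h = h.
    rewrite rmorph_prod /=; under eq_bigr do rewrite map_polyXsubC /= /expf_pchar -exprM -expnSr.
    by rewrite (prod_cyclic_shift (H := fun i => 'X - (alpha ^+ (q ^ i))%:P)) // aj0 expn0.
  by rewrite -{2}Eh coef_map.
have root_p : root (map_poly phi p) alpha.
  by rewrite -Dp /h -(prednK j0_gt0) big_ord_recl rootM expn0 expr1 root_XsubC eqxx.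
have mon_p : p \is monic.
  by rewrite -(map_monic phi) -Dp monic_prod // => i _; apply: monicXsubC.
have sz_p : size p = j0.+1.
  by rewrite -(size_map_poly phi) -Dp size_prod_XsubC /index_enum -enumT size_enum_ord.
have fp : f %| p.
  have [cop | ncop] := boolP (coprimep f p).
    have := cop; rewrite -(coprimep_map phi) => /coprimep_root/(_ root_f).
    by rewrite -[_ != 0]/(~~ root _ _) root_p.
  have := irr_f.2 _ ncop (dvdp_gcdl f p) => /eqp_dvdl <-.
  exact: dvdp_gcdr.
have kj0 : (k <= j0)%N by have := dvdp_leq (monic_neq0 mon_p) fp; rewrite sz_f sz_p.
have j0k : (j0 <= k)%N.
  have : (size [seq alpha ^+ (q ^ j) | j <- iota 0 j0] < size (map_poly phi f))%N.
    apply: max_poly_roots; first by rewrite map_poly_eq0.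
      by apply/allP => _ /mapP[j _ ->]; apply: root_expf_card.
    apply: (uniq_conjugates phi) => j /andP[j_gt0 jj0] /eqP aj.
    by have := min_j0 j; rewrite j_gt0 aj leqNgt jj0; move/(_ isT).
  by rewrite size_map size_iota size_map_poly sz_f ltnS.
have ej0 : j0 = k by apply/eqP; rewrite eqn_leq j0k kj0.
split; last 1 first.
- move=> j aj; rewrite -ej0; rewrite /dvdn -leqn0 leqNgt; apply/negP => r_gt0.
  have per s : alpha ^+ (q ^ (s * j0)) = alpha.
    by elim: s => [|s IH]; rewrite ?expr1 // mulSn expnD exprM aj0.
  have ajm : alpha ^+ (q ^ (j %% j0)) = alpha.
    by rewrite -{1}(per (j %/ j0)%N) -exprM -expnD -divn_eq.
  by have := min_j0 (j %% j0)%N; rewrite r_gt0 ajm eqxx leqNgt ltn_pmod // => /(_ isT).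
- rewrite -ej0 -/h Dp -map_polyZ; congr map_poly.
  have /eqpP[[c1 c2] /= /andP[c10 c20] E] : f %= p.
    by rewrite -dvdp_size_eqp // sz_f sz_p ej0.
  have -> : f = (c2 / c1) *: p.
    by rewrite mulrC -scalerA -E scalerA mulVf ?scale1r.
  by rewrite lead_coefZ (eqP mon_p) mulr1.
by rewrite -ej0.
Qed.

End Conjugates.

(* For a prime p | t, b ^+ u is not a p-th power in the field with Q elements, so
   zeta ^+ (Q - 1) has order exactly t. *)
Lemma radical_period (K : fieldType) (b zeta : K) (n t Q D u s : nat) :
  (0 < n)%N -> (1 < Q)%N -> D = gcdn n (Q - 1) -> D.-primitive_root b ->
  (t %| n %/ D)%N -> coprime u t ->
  (forall p, prime p -> (p %| t)%N -> (p %| Q - 1)%N) ->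
  ((2 %| t)%N -> (4 %| Q - 1)%N) ->
  b ^+ u * zeta ^+ t = 1 -> zeta ^+ (Q ^ s) = zeta -> (t %| s)%N.
Proof.
move=> n_gt0 Q_gt1 DD prim_b tn cop_ut rad_t h2 E zs.
have D_gt0 : (0 < D)%N by rewrite DD gcdn_gt0 n_gt0.
have Dn : (D %| n)%N by rewrite DD dvdn_gcdl.
have nD_gt0 : (0 < n %/ D)%N by rewrite divn_gt0 // dvdn_leq.
have t_gt0 : (0 < t)%N := dvdn_gt0 nD_gt0 tn.
have z0 : zeta != 0.
  apply/eqP => z0; move/eqP: E; rewrite z0 expr0n gtn_eqF // mulr0.
  by rewrite eq_sym oner_eq0.
have powE x : zeta ^+ (t * x) = 1 -> (D %| u * x)%N.
  move=> zx; have := congr1 (fun y => y ^+ x) E.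
  rewrite expr1n exprMn -!exprM zx mulr1 => bux.
  by rewrite (prim_order_dvd prim_b) bux.
pose eta := zeta ^+ (Q - 1).
have eta_t : eta ^+ t = 1.
  have b1 : b ^+ (Q - 1) = 1.
    by apply/eqP; rewrite -(prim_order_dvd prim_b) DD dvdn_gcdr.
  have := congr1 (fun x => x ^+ (Q - 1)) E.
  by rewrite expr1n exprMn -exprM mulnC exprM b1 expr1n mul1r -!exprM mulnC.
have [t' prim_eta t't] := prim_order_exists t_gt0 eta_t.
have et : t' = t.
  apply/eqP/contraT => net.
  have tt'_gt1 : (1 < t %/ t')%N.
    rewrite ltn_neqAle divn_gt0 ?(dvdn_gt0 t_gt0 t't) // (dvdn_leq t_gt0 t't) andbT.
    by rewrite eqn_div ?(dvdn_gt0 t_gt0 t't) // mul1n.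
  pose p := pdiv (t %/ t').
  have pr_p : prime p by rewrite pdiv_prime.
  have pt' : (p * t' %| t)%N.
    by rewrite -(divnK t't) dvdn_mul // pdiv_dvd.
  have pt : (p %| t)%N by apply: dvdn_trans pt'; rewrite dvdn_mulr.
  have [x Dx] : exists x, (Q - 1 = x * p)%N by apply/dvdnP/rad_t.
  (* With Q - 1 = x p, this power is [eta] to the t/p, and the order t' of [eta] divides t/p by the
     choice of p. *)
  have : zeta ^+ (t * x) = 1.
    have -> : (t * x)%N = ((Q - 1) * (t %/ p))%N.
      by rewrite Dx -mulnA [(p * _)%N]mulnC divnK // mulnC.
    rewrite exprM; apply/eqP; rewrite -(prim_order_dvd prim_eta).
    by rewrite -(@dvdn_pmul2l p) ?prime_gt0 // [(p * (t %/ p))%N]mulnC divnK.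
  move/powE => Dux.
  (* As D is the gcd of n and Q - 1, it is enough that p D divides u n and u (Q - 1): the first
     holds since p | t | n/D, the second since D | u x. Cancelling D gives p | u, against the
     coprimality of u and t. *)
  have : (p * D %| u * D)%N.
    rewrite [in (u * D)%N]DD muln_gcdr dvdn_gcd; apply/andP; split.
      apply: dvdn_mull; apply: dvdn_trans (dvdn_mul pt (dvdnn D)) _.
      by rewrite -(divnK Dn) dvdn_mul.
    by rewrite Dx mulnA [(p * D)%N]mulnC dvdn_mul.
  rewrite dvdn_pmul2r // => pu.
  have : (p %| gcdn u t)%N by rewrite dvdn_gcd pu.
  by rewrite (eqP cop_ut) dvdn1 => /eqP p1; rewrite p1 in pr_p.
rewrite et in prim_eta.
apply: (@dvdn_geom_sum t Q) => //; first exact: ltnW.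
(* The geometric sum times Q - 1 is Q^s - 1, so [eta] raised to the sum is zeta^(Q^s - 1) = 1. *)
rewrite (prim_order_dvd prim_eta) -exprM subn1 -predn_exp.
by rewrite -(can_eq (mulfK z0)) mul1r -exprSr prednK ?zs ?expn_gt0 // ltnW.
Qed.

(** The roots of the factors need not lie in [L]. Being finite-dimensional over a finite field, [L]
    is finite, hence countable, and so embeds into a countable algebraic closure. *)
Lemma finvect_closure (F : finFieldType) (L : fieldExtType F) :
  exists K : closedFieldType, inhabited {rmorphism L -> K}.
Proof.
have [K [psi _]] := countable_algebraic_closure (finvect_type L).
by exists K; split; exact: psi.
Qed.

(** * The factors as products of binomials in X^t *)

Section FactorShape.
Variables (K : fieldType) (q k r : nat) (alpha : K).

(** The monic multiple of g_t(c X^t). The scalars beta^(-wk) and theta^(-uk(q+1)) in the factors are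
    exactly the normalisations that produce it. *)
Definition cofactor_poly t (c : K) : {poly K} :=
  \prod_(i < k) ('X^t - (c^-1 * alpha ^+ (t * r * q ^ i))%:P).

Lemma gpoly_comp t c : c != 0 ->
  gpoly q k r alpha t \Po (c *: 'X^t) = c ^+ k *: cofactor_poly t c.
Proof.
move=> c0; rewrite /gpoly rmorph_prod /=.
have -> : c ^+ k *: cofactor_poly t c = \prod_(i < k) c%:P * cofactor_poly t c.
  by rewrite prodr_const card_ord -polyC_exp mul_polyC.
rewrite -big_split /=; apply: eq_bigr => i _.
by rewrite rmorphB /= comp_polyX comp_polyC mulrBr mul_polyC -polyCM mulVKf.
Qed.

Lemma factor1E theta t w : theta != 0 ->
  factor1 q k r alpha theta t w = cofactor_poly t (theta ^+ w).
Proof.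
move=> b0; rewrite /factor1 gpoly_comp ?expf_neq0 // scalerA -exprM.
by rewrite mulVf ?scale1r // expf_neq0.
Qed.

Lemma factor2E theta t u : theta != 0 ->
  factor2 q k r alpha theta t u =
  cofactor_poly t (theta ^+ u) * cofactor_poly t (theta ^+ (u * q)).
Proof.
move=> b0; rewrite /factor2 !gpoly_comp ?expf_neq0 //.
rewrite -scalerAl -scalerAr !scalerA -!exprM -mulrA -exprD.
rewrite (_ : u * k + u * q * k = u * k * (q + 1))%N; last by ring.
by rewrite mulVf ?scale1r // expf_neq0.
Qed.

Lemma cofactor_poly_monic t c : (0 < t)%N -> cofactor_poly t c \is monic.
Proof. by move=> t_gt0; apply: monic_prod => i _; apply: monicXnsubC. Qed.

Lemma size_cofactor_poly t c : (0 < t)%N -> size (cofactor_poly t c) = (k * t).+1.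
Proof.
move=> t_gt0; rewrite size_prod => [|i _]; last by rewrite monic_neq0 ?monicXnsubC.
under eq_bigr do rewrite size_XnsubC //.
by rewrite sum_nat_const card_ord mulnS; lia.
Qed.

Lemma root_cofactor_poly (K' : fieldType) (psi : {rmorphism K -> K'}) t c y : c != 0 ->
  reflect (exists2 i, (i < k)%N & psi c * y ^+ t = psi alpha ^+ (t * r * q ^ i))
    (root (map_poly psi (cofactor_poly t c)) y).
Proof.
move=> c0; have c0' : psi c != 0 by rewrite fmorph_eq0.
rewrite /cofactor_poly rmorph_prod /= /root horner_prod.
have E i : (map_poly psi ('X^t - (c^-1 * alpha ^+ (t * r * q ^ i))%:P)).[y] =
   (psi c)^-1 * (psi c * y ^+ t - psi alpha ^+ (t * r * q ^ i)).
  rewrite rmorphB /= map_polyXn map_polyC /= !hornerE mulrBr mulKf //.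
  by rewrite rmorphM rmorphXn fmorphV.
apply: (iffP (prodf_eq0 _ _)) => [[i _] | [i ik Ei]].
  rewrite E mulf_eq0 invr_eq0 (negPf c0') subr_eq0 => /eqP Ei.
  by exists i.
by exists (Ordinal ik) => //=; rewrite E Ei subrr mulr0.
Qed.

(** Frobenius permutes the conjugates of alpha cyclically, so only c moves. Thus one such polynomial
    descends when c^q = c, and the product for c and c^q descends when c^(q^2) = c. *)
Lemma map_expf_cofactor_poly t c (hq : [pchar K].-nat q) : alpha ^+ (q ^ k) = alpha ->
  map_poly (expf_pchar hq) (cofactor_poly t c) = cofactor_poly t (c ^+ q).
Proof.
move=> ak; rewrite rmorph_prod /=.
pose H i := 'X^t - ((c ^+ q)^-1 * alpha ^+ (t * r * q ^ i))%:P.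
rewrite -[RHS](@prod_cyclic_shift _ k H); last first.
  by rewrite /H ![(t * r * _)%N]mulnC !exprM ak expn0 expr1.
apply: eq_bigr => i _; rewrite /H rmorphB /= map_polyXn map_polyC /=.
by rewrite {1}/expf_pchar exprMn exprVn -exprM expnSr mulnA.
Qed.

End FactorShape.

Lemma expr_eq1_neq0 (K : fieldType) (x : K) j : (0 < j)%N -> x ^+ j = 1 -> x != 0.
Proof.
move=> j_gt0 xj; apply/eqP => x0; move/eqP: xj.
by rewrite x0 expr0n gtn_eqF // eq_sym oner_eq0.
Qed.

(** * Consequences of the hypotheses on q, n, theta and alpha *)

Section Setting.
Variables (F : finFieldType) (n : nat) (f : {poly F}) (k e d : nat).
Variables (L : fieldExtType F) (theta : L) (m r : nat) (alpha : L) (l : nat).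
Local Notation q := #|F|.
Local Notation G := (gcdn n (q - 1)).
Hypotheses (hq4 : q = 3 %[mod 4]) (n_gt0 : (0 < n)%N) (hn8 : (8 %| n)%N).
Hypothesis hnq : forall p : nat, prime p -> (p %| n)%N -> (p %| q - 1)%N.
Hypotheses (hirr : irreducible_poly f) (hk : size f = k.+1).
Hypotheses (he : poly_has_order f e) (hcop : coprime n (e * k)).
Hypotheses (hd : d = gcdn n (q ^ 2 - 1)) (hthetad : d.-primitive_root theta).
Hypotheses (hm : m = (n %/ d)%N) (hr : (n * r)%N = 1%N %[mod e]).
Hypothesis halpha : root (map_poly (in_alg L) f) alpha.
Hypotheses (l_gt1 : (2 <= l)%N) (Dd : d = (2 ^ l * G)%N).
Local Notation beta := (theta ^+ (2 ^ l)).

Lemma q_gt1 : (1 < q)%N.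
Proof. by move: hq4; case: #|F| => [|[]]. Qed.

Lemma d_gt0 : (0 < d)%N. Proof. exact: prim_order_gt0 hthetad. Qed.

Lemma d_dvd_n : (d %| n)%N. Proof. by rewrite hd dvdn_gcdl. Qed.

Lemma n_eq : n = (d * m)%N. Proof. by rewrite hm mulnC divnK // d_dvd_n. Qed.

Lemma m_gt0 : (0 < m)%N. Proof. by rewrite hm divn_gt0 ?d_gt0 // dvdn_leq ?d_dvd_n. Qed.

Lemma dvdm_dvdn t : (t %| m)%N -> (t %| n)%N.
Proof. by move=> tm; rewrite n_eq dvdn_mull. Qed.

Lemma dvdm_gt0 t : (t %| m)%N -> (0 < t)%N.
Proof. exact: dvdn_gt0 m_gt0. Qed.

Lemma rad_G p : prime p -> (p %| n)%N -> (p %| G)%N.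
Proof. by move=> pr_p pn; rewrite dvdn_gcd pn hnq. Qed.

Lemma rad_d p : prime p -> (p %| n)%N -> (p %| d)%N.
Proof. by move=> pr_p pn; rewrite Dd dvdn_mull // rad_G. Qed.

Lemma two_dvd_n : (2 %| n)%N. Proof. exact: dvdn_trans hn8. Qed.

Lemma sqr_mod_d : q ^ 2 = 1 %[mod d].
Proof.
apply/eqP; rewrite eqn_mod_dvd ?expn_gt0 ?finField_card_gt0 //.
by rewrite hd dvdn_gcdr.
Qed.

Lemma coprime_q_n : coprime q n.
Proof.
rewrite coprime_primes //; apply/allP => p; rewrite mem_primes => /and3P[pr_p _ pn].
apply/negP => pq; have := dvdn_sub pq (hnq pr_p pn).
by rewrite subKn ?finField_card_gt0 // dvdn1 => /eqP p1; rewrite p1 in pr_p.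
Qed.

(** The hypothesis says that theta^u is fixed by Frobenius. Since [G] is even, 2^(l+1) divides d,
    while q - 1 absorbs only one factor 2. *)
Lemma frobenius_index u : (d %| u * (q - 1))%N -> (2 ^ l %| u)%N.
Proof.
have [o Do odd_o] : exists2 o, (q - 1 = 2 * o)%N & odd o.
  move: hq4 q_gt1; clear; move: #|F| => x x4 x1.
  by exists ((x - 1) %/ 2)%N; lia.
have [g Dg] : exists g, G = (g * 2)%N by apply/dvdnP/rad_G => //; apply: two_dvd_n.
move=> du; have : (2 ^ l * 2 %| u * (q - 1))%N.
  by apply: dvdn_trans du; rewrite Dd dvdn_mul // Dg dvdn_mull.
rewrite Do mulnCA [(_ * 2)%N]mulnC dvdn_pmul2l // Gauss_dvdl //.
by rewrite coprimeXl // coprime2n.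
Qed.

Lemma beta_primitive : G.-primitive_root beta.
Proof.
have G_gt0 : (0 < G)%N by rewrite gcdn_gt0 n_gt0.
have Gd : (G %| d)%N by rewrite Dd dvdn_mull.
by have := dvdn_prim_root hthetad Gd; rewrite {1}Dd mulnK.
Qed.

Lemma theta_neq0 : theta != 0.
Proof. exact: expr_eq1_neq0 d_gt0 (prim_expr_order hthetad). Qed.

Lemma dvd_d_divn t : (t %| m)%N -> (d %| n %/ t)%N.
Proof. by move=> tm; rewrite n_eq -muln_divA // dvdn_mulr. Qed.

Lemma alpha_exp_e : alpha ^+ e = 1.
Proof.
case: he => _ _ fe _; have : root (map_poly (in_alg L) ('X^e - 1)) alpha.
  by apply: root_dvdp halpha; rewrite dvdp_map.
rewrite rmorphB /= map_polyXn rmorph1 /root !hornerE subr_eq0.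
by move/eqP.
Qed.

Lemma alpha_neq0 : alpha != 0.
Proof.
by have [_ e_gt0 _ _] := he; apply: expr_eq1_neq0 alpha_exp_e.
Qed.

Lemma alpha_exp_nr : alpha ^+ (n * r) = alpha.
Proof. by rewrite -(expr_mod _ alpha_exp_e) hr (expr_mod _ alpha_exp_e). Qed.

Lemma alpha_period j : alpha ^+ (q ^ j) = alpha -> (k %| j)%N.
Proof. by have [_ _] := irreducible_root_conjugates hirr hk halpha; apply. Qed.

Lemma k_gt0 : (0 < k)%N.
Proof. by have := hirr.1; rewrite hk ltnS. Qed.

Lemma alpha_conj_k : alpha ^+ (q ^ k) = alpha.
Proof. by have [_ ak _] := irreducible_root_conjugates hirr hk halpha. Qed.

(** * Irreducibility of the two kinds of factors *)

Section Closure.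
Variables (K : closedFieldType) (psi : {rmorphism L -> K}).

(** Raising the equation of y to the power n/t removes c and leaves y^n = alpha^(q^i). If y is
    fixed, so is alpha, whence k | j. Then A = alpha^(r q^i) is fixed too, and so is zeta = y/A. *)
Lemma cofactor_period t c y j : (t %| m)%N -> c ^+ (n %/ t) = 1 ->
  root (map_poly psi (cofactor_poly q k r alpha t c)) y -> y ^+ (q ^ j) = y ->
  (k %| j)%N /\ exists2 zeta, psi c * zeta ^+ t = 1 & zeta ^+ (q ^ j) = zeta.
Proof.
move=> tm cn; have tn := dvdm_dvdn tm; have t_gt0 := dvdm_gt0 tm.
have c0 : c != 0 by apply: expr_eq1_neq0 cn; rewrite divn_gt0 // dvdn_leq.
have c0' : psi c != 0 by rewrite fmorph_eq0.
case/root_cofactor_poly=> // i ik Ey yj.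
have a0 : psi alpha != 0 by rewrite fmorph_eq0 alpha_neq0.
have yn : y ^+ n = psi alpha ^+ (q ^ i).
  have := congr1 (fun x => x ^+ (n %/ t)) Ey.
  rewrite exprMn -[psi c ^+ _]rmorphXn cn rmorph1 mul1r -!exprM [(t * (_ %/ _))%N]mulnC divnK // => ->.
  rewrite -!rmorphXn; congr (psi _).
  rewrite (_ : t * r * q ^ i * (n %/ t) = n %/ t * t * r * q ^ i)%N; last by ring.
  by rewrite divnK // exprM alpha_exp_nr.
have kj : (k %| j)%N.
  apply: alpha_period; apply: (fmorph_inj psi); rewrite rmorphXn.
  apply: (expf_pchar_inj (pchar_nat_cardX (psi \o in_alg L) i)) => /=.
  by rewrite -exprM mulnC exprM -yn -exprM mulnC exprM yj.
split=> //; pose A := psi alpha ^+ (r * q ^ i).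
have A0 : A != 0 by rewrite expf_neq0.
exists (y / A).
  rewrite expr_div_n mulrA Ey -exprM (_ : r * q ^ i * t = t * r * q ^ i)%N; last by ring.
  by rewrite divff // expf_neq0.
rewrite expr_div_n yj; congr (_ / _); case/dvdnP: kj => s ->.
rewrite /A -!rmorphXn -exprM mulnC exprM; congr (psi (_ ^+ _)).
elim: s => [|s IH]; first by rewrite expr1.
by rewrite mulSn expnD exprM alpha_conj_k.
Qed.

End Closure.

Lemma irreducible_factor1 t w : (t %| m)%N -> odd t -> coprime w t ->
  irreducible_over (factor1 q k r alpha beta t w).
Proof.
move=> tm odd_t cop_wt; have [K [psi]] := finvect_closure L.
have t_gt0 := dvdm_gt0 tm; have k_gt0 := k_gt0.
have th0 := theta_neq0.
have b0 : beta != 0 by rewrite expf_neq0.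
have prim_b := beta_primitive.
have bq : beta ^+ q = beta.
  rewrite -[q](subnK (finField_card_gt0 F)) addn1 exprSr.
  by rewrite (eqP (_ : beta ^+ (q - 1) == 1)) ?mul1r // -(prim_order_dvd prim_b) dvdn_gcdr.
rewrite factor1E //; set P := cofactor_poly _ _ _ _ _ _.
have [p Dp] : exists p : {poly F}, P = map_poly (in_alg L) p.
  apply: descend_poly => i.
  have EP : map_poly (expf_pchar (pchar_nat_card (in_alg L))) P = P.
    by rewrite map_expf_cofactor_poly ?alpha_conj_k // -exprM mulnC exprM bq.
  by rewrite -{2}EP coef_map.
have szp : size p = (k * t).+1.
  by rewrite -(size_map_poly (in_alg L)) -Dp size_cofactor_poly.
exists p => //.
apply: (irreducible_conjugates (phi := psi \o in_alg L) szp); first by rewrite muln_gt0 k_gt0.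
move=> y j; rewrite map_poly_comp -Dp => ry yj.
have cn : (beta ^+ w) ^+ (n %/ t) = 1.
  apply/eqP; rewrite -exprM -(prim_order_dvd prim_b) dvdn_mull //.
  by apply: dvdn_trans (dvd_d_divn tm); rewrite Dd dvdn_mull.
have [kj [zeta Ez zj]] := cofactor_period tm cn ry yj.
rewrite Gauss_dvd ?kj /=; last first.
  by move: hcop; rewrite coprimeMr => /andP[_ cnk]; rewrite coprime_sym (coprime_dvdl (dvdm_dvdn tm)).
apply: (@radical_period K (psi beta) zeta n t q G w) => //.
- exact: q_gt1.
- by rewrite fmorph_primitive_root.
(* Here n/G = 2^l m. *)
- by rewrite {1}n_eq Dd -mulnA mulnCA mulKn ?dvdn_mull // gcdn_gt0 n_gt0.
- by move=> p' pr_p' p't; apply: hnq => //; apply: dvdn_trans p't (dvdm_dvdn tm).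
- by rewrite dvdn2 odd_t.
by rewrite -rmorphXn.
Qed.

(** A root belongs to one half, with exponent v = u or uq satisfying the same conditions as u. Its
    period j is even because theta^v is not fixed by Frobenius, so j = 2s, and q^2 can replace q,
    with 4 | q^2 - 1. As k is coprime to the even number n, it is odd and prime to t, so 2, k and t
    combine to 2kt | j. *)
Lemma irreducible_factor2 t u : (t %| m)%N -> coprime u t -> ~~ (2 ^ l %| u)%N ->
  irreducible_over (factor2 q k r alpha theta t u).
Proof.
move=> tm cop_ut lu; have [K [psi]] := finvect_closure L.
have t_gt0 := dvdm_gt0 tm; have k_gt0 := k_gt0.
have th0 := theta_neq0.
have tq2 v : theta ^+ (v * q * q) = theta ^+ v.
  rewrite -mulnA mulnn mulnC exprM; congr (_ ^+ _).
  by rewrite -(prim_expr_mod hthetad) sqr_mod_d (prim_expr_mod hthetad).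
rewrite factor2E //; set P := _ * _.
have [p Dp] : exists p : {poly F}, P = map_poly (in_alg L) p.
  apply: descend_poly => i.
  have EP : map_poly (expf_pchar (pchar_nat_card (in_alg L))) P = P.
    by rewrite rmorphM /= !map_expf_cofactor_poly ?alpha_conj_k // -!exprM tq2 mulrC.
  by rewrite -{2}EP coef_map.
have szp : size p = (2 * (k * t)).+1.
  rewrite -(size_map_poly (in_alg L)) -Dp size_Mmonic ?cofactor_poly_monic //.
    by rewrite !size_cofactor_poly // mul2n -addnn addnS.
  by rewrite monic_neq0 ?cofactor_poly_monic.
exists p => //.
apply: (irreducible_conjugates (phi := psi \o in_alg L) szp).
  by rewrite !muln_gt0 k_gt0.
move=> y j; rewrite map_poly_comp -Dp => ry yj.
have cop_qt : coprime q t by apply: coprime_dvdr (dvdm_dvdn tm) coprime_q_n.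
have [v [cop_vt lv rv]] : exists v, [/\ coprime v t, ~~ (2 ^ l %| v)%N &
    root (map_poly psi (cofactor_poly q k r alpha t (theta ^+ v))) y].
  move: ry; rewrite rmorphM rootM => /orP[] ry; first by exists u.
  exists (u * q)%N; split=> //; first by rewrite coprimeMl cop_ut.
  rewrite Gauss_dvdl // coprime_sym coprimeXr // coprime_sym.
  exact: coprime_dvdl two_dvd_n (etrans (coprime_sym _ _) coprime_q_n).
have cn : (theta ^+ v) ^+ (n %/ t) = 1.
  by apply/eqP; rewrite -exprM -(prim_order_dvd hthetad) dvdn_mull // dvd_d_divn.
have [kj [zeta Ez zj]] := cofactor_period tm cn rv yj.
have even_j : ~~ odd j.
  apply: contra lv => odd_j; apply: frobenius_index.
  rewrite mulnBr muln1 -eqn_mod_dvd ?leq_pmulr ?finField_card_gt0 //.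
  (* For odd j, q^j = q mod d; and theta^v, the inverse of zeta^t in the closure, is fixed by q^j
     since zeta is. *)
  have -> : (v * q)%N = (v * q ^ j)%N %[mod d].
    rewrite -(odd_double_half j) odd_j -mul2n expnD expn1 expnM mulnA.
    by rewrite -[RHS]modnMmr -modnXm sqr_mod_d modnXm exp1n modnMmr muln1.
  rewrite -(eq_prim_root_expr hthetad); apply/eqP/(fmorph_inj psi).
  have z0 : zeta ^+ t != 0.
    by apply/eqP => zt; move/eqP: Ez; rewrite zt mulr0 eq_sym oner_eq0.
  rewrite exprM rmorphXn; apply: (mulIf z0).
  by rewrite Ez -{1}zj exprAC -exprMn Ez expr1n.
have [s Dj] : exists s, j = (2 * s)%N by exists j./2; rewrite mul2n even_halfK.
rewrite Dj dvdn_pmul2l // Gauss_dvd; last first.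
  by move: hcop; rewrite coprimeMr => /andP[_ cnk]; rewrite coprime_sym (coprime_dvdl (dvdm_dvdn tm)).
apply/andP; split.
  move: kj; rewrite Dj Gauss_dvdr // coprime_sym.
  by move: hcop; rewrite coprimeMr => /andP[_]; apply: coprime_dvdl two_dvd_n.
apply: (@radical_period K (psi theta) zeta n t (q ^ 2) d v) => //.
- by rewrite -(exp1n 2) ltn_exp2r ?q_gt1.
- by rewrite fmorph_primitive_root.
- by rewrite -hm.
- move=> p' pr_p' p't; apply: dvdn_trans (hnq pr_p' (dvdn_trans p't (dvdm_dvdn tm))) _.
  by rewrite -[X in (_ %| _ - X)%N](exp1n 2) subn_sqr dvdn_mulr.
- move=> _; rewrite -[X in (_ %| _ - X)%N](exp1n 2) subn_sqr dvdn_mull //.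
  by rewrite /dvdn -modnDml hq4.
- by rewrite -rmorphXn.
by rewrite -expnM -Dj.
Qed.

(** * Separability and roots of f(X^n) *)

Lemma natr_n_neq0 : n%:R != 0 :> F.
Proof.
have pF : pdiv q \in [pchar F].
  have /andP[_ /allP] := pchar_nat_card (idfun : {rmorphism F -> F}).
  by apply; rewrite mem_primes pdiv_prime ?q_gt1 ?pdiv_dvd ?finField_card_gt0.
rewrite -(dvdn_pcharf pF); apply/negP => pn.
have := coprime_q_n; rewrite /coprime => /eqP gqn.
have : (pdiv q %| gcdn q n)%N by rewrite dvdn_gcd pdiv_dvd.
by rewrite gqn dvdn1 => /eqP p1; move: (pcharf_prime pF); rewrite p1.
Qed.

Lemma separable_f : separable_poly f.
Proof.
rewrite -(separable_map (in_alg L)).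
have [-> _ _] := irreducible_root_conjugates hirr hk halpha.
have lf0 : in_alg L (lead_coef f) != 0.
  by rewrite fmorph_eq0 lead_coef_eq0 -size_poly_gt0 hk.
rewrite (eqp_separable (eqp_scale _ lf0)).
rewrite -(big_mkord xpredT (fun i => 'X - (alpha ^+ (q ^ i))%:P)).
rewrite -(big_map (fun i => alpha ^+ (q ^ i)) xpredT (fun x => 'X - x%:P)).
rewrite separable_prod_XsubC /index_iota subn0.
apply: (uniq_conjugates (in_alg L)) => j /andP[j_gt0 jk] /alpha_period/(dvdn_leq j_gt0).
by rewrite leqNgt jk.
Qed.

(** The derivative is n X^(n-1) f'(X^n): n is invertible in [F], X is prime to f(X^n) because f(0)
    is nonzero, and f'(X^n) is prime to it because f is separable. *)
Lemma separable_comp_Xn : separable_poly (f \Po 'X^n).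
Proof.
rewrite unlock deriv_comp derivXn -scaler_nat coprimepMr.
rewrite coprimep_comp_poly; last by move: separable_f; rewrite unlock.
rewrite coprimepZr ?natr_n_neq0 // coprimep_expr // -[X in coprimep _ X]subr0.
rewrite coprimep_XsubC /root horner_comp hornerXn expr0n gtn_eqF //.
by case: he.
Qed.

Lemma size_comp_fXn : size (f \Po 'X^n) = (k * n).+1.
Proof.
have := size_comp_poly f 'X^n; rewrite hk size_polyXn /= => <-.
rewrite prednK // size_poly_gt0; apply/eqP => fn0.
have [/eqP f00 _ _ _] := he; apply: f00.
by have := horner_comp f 'X^n 0; rewrite fn0 hornerXn expr0n gtn_eqF // horner0.
Qed.

Lemma root_exists_factor (K : closedFieldType) (psi : {rmorphism L -> K}) y :
  root (map_poly psi (map_poly (in_alg L) (f \Po 'X^n))) y ->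
  exists t u, [/\ (t %| m)%N, (0 < u <= d)%N, coprime u t &
    root (map_poly psi (cofactor_poly q k r alpha t (theta ^+ u))) y].
Proof.
rewrite !map_comp_poly !map_polyXn root_comp hornerXn => ryn.
have [i ik yn] : exists2 i, (i < k)%N & y ^+ n = psi alpha ^+ (q ^ i).
  move: ryn; have [-> _ _] := irreducible_root_conjugates hirr hk halpha.
  rewrite map_polyZ rmorph_prod rootZ; last first.
    by rewrite !fmorph_eq0 lead_coef_eq0 -size_poly_gt0 hk.
  rewrite /root horner_prod => /prodf_eq0[i _].
  by rewrite /= map_polyXsubC !hornerE subr_eq0 rmorphXn => /eqP ->; exists i.
have a0 : psi alpha != 0 by rewrite fmorph_eq0 alpha_neq0.
pose A := psi alpha ^+ (r * q ^ i).
have A0 : A != 0 by rewrite expf_neq0.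
pose zeta := y / A; have yE : y = zeta * A by rewrite divfK.
have zn : zeta ^+ n = 1.
  rewrite expr_div_n yn /A -exprM (_ : r * q ^ i * n = n * r * q ^ i)%N; last by ring.
  by rewrite exprM -!rmorphXn alpha_exp_nr divff // fmorph_eq0 expf_neq0 ?alpha_neq0.
have [N prim_z Nn] := prim_order_exists n_gt0 zn.
have prim_th : d.-primitive_root (psi theta) by rewrite fmorph_primitive_root.
have N_gt0 := dvdn_gt0 n_gt0 Nn; have d_gt0 := d_gt0.
pose g := gcdn N d; have g_gt0 : (0 < g)%N by rewrite gcdn_gt0 N_gt0.
(* The power zeta^t has order g, which divides d, so it is a power of theta. Coprimality of t and d'
   gives t | m, because N = t g divides n = d' g m. *)
pose t := (N %/ g)%N; pose d' := (d %/ g)%N.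
have DN : N = (t * g)%N by rewrite divnK // dvdn_gcdl.
have Ddg : d = (d' * g)%N by rewrite divnK // dvdn_gcdr.
have cop_td' : coprime t d'.
  by rewrite /coprime -(eqn_pmul2r g_gt0) muln_gcdl -DN -Ddg mul1n.
have t_gt0 : (0 < t)%N by move: N_gt0; rewrite DN muln_gt0 => /andP[].
have tm : (t %| m)%N.
  rewrite -(Gauss_dvdr m cop_td') -(dvdn_pmul2r g_gt0) -DN.
  by rewrite mulnAC -Ddg -n_eq.
have [u' Eu'] : {u' : 'I_d | zeta ^+ t = psi theta ^+ u'}.
  apply: (prim_rootP prim_th); apply/eqP.
  by rewrite -exprM -(prim_order_dvd prim_z) DN Ddg mulnCA dvdn_mull.
(* The inverse exponent, taken in the range 1..d: u' = 0 becomes u = d. *)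
pose u := (d - u')%N.
have u_gt0 : (0 < u)%N by rewrite subn_gt0.
have Eu : psi theta ^+ u * zeta ^+ t = 1.
  by rewrite Eu' -exprD subnK ?(prim_expr_order prim_th) // ltnW.
have cop_ut : coprime u t.
  rewrite coprime_primes //; apply/allP => p.
  rewrite mem_primes => /and3P[pr_p _ pt]; apply/negP => pu.
  have pd : (p %| d)%N by apply: rad_d => //; apply: dvdn_trans pt (dvdm_dvdn tm).
  have [t1 Dt] := dvdnP pt; have [u1 Du] := dvdnP pu; have [d1 Dd1] := dvdnP pd.
  (* The base is a p-th root of unity and p | d. Hence zeta^(t1 d) = 1, so t g | t1 d' g with t = t1
     p, and p would divide both t and d'. *)
  have Ed : (psi theta ^+ u1 * zeta ^+ t1) ^+ d = 1.
    have := congr1 (fun x => x ^+ d1) Eu; rewrite expr1n => <-.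
    by rewrite Dt Du Dd1 !exprMn -!exprM -!mulnA [(p * d1)%N]mulnC.
  move: Ed; rewrite exprMn -exprM mulnC exprM (prim_expr_order prim_th) expr1n mul1r.
  rewrite -exprM => /eqP; rewrite -(prim_order_dvd prim_z) DN Ddg mulnA dvdn_pmul2r //.
  have t1_gt0 : (0 < t1)%N by move: t_gt0; rewrite Dt muln_gt0 => /andP[].
  rewrite Dt dvdn_pmul2l // => pd'.
  have : (p %| gcdn t d')%N by rewrite dvdn_gcd pt.
  by rewrite (eqP cop_td') dvdn1 => /eqP p1; rewrite p1 in pr_p.
exists t, u; split=> //; first by rewrite u_gt0 leq_subr.
apply/root_cofactor_poly; first by rewrite expf_neq0 ?theta_neq0.
exists i => //; rewrite rmorphXn yE exprMn mulrA Eu mul1r /A -exprM.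
by congr (_ ^+ _); ring.
Qed.

(** * The list of factors and the product formula *)

Variable R : nat -> {set 'I_d.+1}.
Hypothesis hR : forall t, (t %| m)%N -> representatives q (index_set d l t) (R t).

Definition factor1_seq : seq {poly L} :=
  [seq factor1 q k r alpha beta t w | t <- [seq t <- divisors m | odd t],
     w <- [seq w <- index_iota 1 G.+1 | coprime w t]].

Definition factor2_seq : seq {poly L} :=
  [seq factor2 q k r alpha theta t u | t <- divisors m, u <- map val (enum (R t))].

Definition factor_seq := factor1_seq ++ factor2_seq.

Lemma prod_factor_seq : \prod_(P <- factor_seq) P =
  (\prod_(t <- divisors m | odd t)
     \prod_(1 <= w < G.+1 | coprime w t) factor1 q k r alpha beta t w)
  * (\prod_(t <- divisors m) \prod_(u in R t) factor2 q k r alpha theta t u).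
Proof.
rewrite big_cat /= !big_allpairs_dep big_filter; congr (_ * _).
  by apply: eq_bigr => t _; rewrite big_filter.
by apply: eq_bigr => t _; rewrite big_map big_enum.
Qed.

Lemma factor_seqP P : reflect
  ((exists t w, [/\ (t %| m)%N, odd t, (1 <= w <= G)%N, coprime w t &
      P = factor1 q k r alpha beta t w])
   \/ (exists t (u : 'I_d.+1), [/\ (t %| m)%N, u \in R t &
      P = factor2 q k r alpha theta t u])) (P \in factor_seq).
Proof.
have dvdm t : (t \in divisors m) = (t %| m)%N by rewrite dvdn_divisors ?m_gt0.
rewrite mem_cat; apply: (iffP orP) => -[].
- case/allpairsPdep=> t [w []]; rewrite !mem_filter mem_index_iota ltnS dvdm.
  by move=> /andP[odd_t tm] /andP[cop_wt hw] ->; left; exists t, w.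
- case/allpairsPdep=> t [w []]; rewrite dvdm => tm /mapP[u].
  by rewrite mem_enum => uR -> ->; right; exists t, u.
- case=> t [w [tm odd_t hw cop_wt ->]]; left; apply/allpairsPdep.
  by exists t, w; rewrite !mem_filter mem_index_iota ltnS dvdm odd_t tm cop_wt.
case=> t [u [tm uR ->]]; right; apply/allpairsPdep.
exists t, (val u); split=> //; first by rewrite dvdm.
by apply: map_f; rewrite mem_enum.
Qed.

Lemma R_index t (u : 'I_d.+1) : (t %| m)%N -> u \in R t ->
  coprime u t /\ ~~ (2 ^ l %| u)%N.
Proof. by move=> /hR[/subsetP RS _] /RS; rewrite inE => /and3P[]. Qed.

Lemma factor_seq_irreducible P : P \in factor_seq -> irreducible_over P.
Proof.
case/factor_seqP=> [[t [w [tm odd_t _ cop_wt ->]]] | [t [u [tm uR ->]]]].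
  exact: irreducible_factor1.
by have [cop_ut lu] := R_index tm uR; apply: irreducible_factor2.
Qed.

Lemma beta_neq0 : beta != 0. Proof. by rewrite expf_neq0 ?theta_neq0. Qed.

Lemma factor1_monic t w : (t %| m)%N -> factor1 q k r alpha beta t w \is monic.
Proof. by move=> /dvdm_gt0 t_gt0; rewrite factor1E ?beta_neq0 // cofactor_poly_monic. Qed.

Lemma factor2_monic t u : (t %| m)%N -> factor2 q k r alpha theta t u \is monic.
Proof.
by move=> /dvdm_gt0 t_gt0; rewrite factor2E ?theta_neq0 // rpredM ?cofactor_poly_monic.
Qed.

Lemma factor_seq_monic P : P \in factor_seq -> P \is monic.
Proof.
case/factor_seqP=> [[t [w [tm _ _ _ ->]]] | [t [u [tm _ ->]]]].
  exact: factor1_monic.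
exact: factor2_monic.
Qed.

Lemma card_index_set_R t : (t %| m)%N -> #|index_set d l t| = (2 * #|R t|)%N.
Proof.
move=> tm; apply: (@card_index_set q) (hR tm).
- exact: dvdm_gt0.
- by move=> p pr_p pt; apply: rad_d => //; apply: dvdn_trans (dvdm_dvdn tm).
- exact: sqr_mod_d.
- by rewrite Dd dvdn_mulr.
- exact: finField_card_gt0.
exact: frobenius_index.
Qed.

Lemma rad_m p : prime p -> (p %| m)%N -> (p %| G)%N.
Proof. by move=> pr_p pm; apply: rad_G (dvdm_dvdn pm). Qed.

Lemma size_prod_factor_seq : size (\prod_(P <- factor_seq) P) = (k * n).+1.
Proof.
have szs (s : seq {poly L}) : {in s, forall P, P \is monic} ->
    size (\prod_(P <- s) P) = (\sum_(P <- s) (size P).-1).+1.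
  elim: s => [|P s IH] mon_s; first by rewrite !big_nil size_poly1.
  have mon_P : P \is monic by rewrite mon_s ?mem_head.
  have mon_s' : {in s, forall P, P \is monic}.
    by move=> Q Qs; rewrite mon_s // in_cons Qs orbT.
  rewrite !big_cons size_Mmonic ?monic_neq0 //; last first.
    by rewrite big_seq monic_prod.
  by rewrite IH // addnS /= -(prednK (_ : 0 < size P)%N) // size_poly_gt0 monic_neq0.
rewrite szs; last exact: factor_seq_monic.
have E := @total_degree l G m (fun t => #|R t|) l_gt1 m_gt0 rad_m.
rewrite -Dd -n_eq in E; rewrite -E; last exact: card_index_set_R.
rewrite big_cat /= !big_allpairs_dep big_filter mulnDr !big_distrr /=.
congr (_ + _).+1; last first.
  apply: eq_big_seq => t; rewrite -dvdn_divisors ?m_gt0 // => tm.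
  have t_gt0 := dvdm_gt0 tm.
  rewrite big_map (eq_bigr (fun=> 2 * (k * t))%N) => [|u _]; last first.
    rewrite factor2E ?theta_neq0 // size_Mmonic ?monic_neq0 ?cofactor_poly_monic //.
    by rewrite !size_cofactor_poly // mul2n -addnn addnS.
  by rewrite big_const_seq count_predT iter_addn_0 -cardE; ring.
rewrite big_seq_cond [RHS]big_seq_cond; apply: eq_bigr => t /andP[].
rewrite -dvdn_divisors ?m_gt0 // => /dvdm_gt0 t_gt0 _.
rewrite big_filter /coprime_count mulnA big_distrr /=; apply: eq_bigr => w _.
by rewrite factor1E ?beta_neq0 // size_cofactor_poly // muln1.
Qed.

(** If u = 2^l w, then u coprime to t makes t odd, and y is a root in the first family. Otherwise u
    equals v or vq modulo d for its representative v, and the two halves of the factor for v cover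
    both cases. *)
Lemma root_prod_factor_seq (K : closedFieldType) (psi : {rmorphism L -> K}) y :
  root (map_poly psi (map_poly (in_alg L) (f \Po 'X^n))) y ->
  root (map_poly psi (\prod_(P <- factor_seq) P)) y.
Proof.
case/root_exists_factor=> t [u [tm /andP[u_gt0 ud] cop_ut ry]].
suff [P Pin rP] : exists2 P, P \in factor_seq & root (map_poly psi P) y.
  apply: root_dvdp rP; rewrite dvdp_map.
  by rewrite (big_rem _ Pin) /= dvdp_mulr.
have [lu|lu] := boolP (2 ^ l %| u)%N.
  have [w Du] := dvdnP lu; exists (factor1 q k r alpha beta t w).
    apply/factor_seqP; left; exists t, w; split=> //.
    - by move: cop_ut; rewrite Du coprimeMl coprime_pexpl ?(ltnW l_gt1) // coprime2n => /andP[].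
    - move: u_gt0 ud; rewrite Du Dd [(w * _)%N]mulnC leq_pmul2l ?expn_gt0 //.
      by rewrite muln_gt0 => /andP[_ ->].
    by move: cop_ut; rewrite Du coprimeMl => /andP[].
  by rewrite factor1E ?beta_neq0 // -exprM mulnC -Du.
have uS : Ordinal (ud : (u < d.+1)%N) \in index_set d l t.
  by rewrite inE u_gt0 cop_ut lu.
have [_ /(_ _ uS)[v [[vR uv] _]]] := hR tm.
exists (factor2 q k r alpha theta t v).
  by apply/factor_seqP; right; exists t, v.
rewrite factor2E ?theta_neq0 // rmorphM rootM.
have thE x z : x = z %[mod d] -> theta ^+ x = theta ^+ z.
  by move=> xz; apply/eqP; rewrite (eq_prim_root_expr hthetad) xz.
by case: (q_equiv2 sqr_mod_d uv) => /thE /= <-; rewrite ry ?orbT.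
Qed.

Lemma comp_fXn_factorization :
  map_poly (in_alg L) (f \Po 'X^n) =
  in_alg L (lead_coef f) *: \prod_(P <- factor_seq) P.
Proof.
have [K [psi]] := finvect_closure L.
set p := map_poly _ _; set Q := \prod_(P <- _) _.
have sz_p : size p = (k * n).+1 by rewrite size_map_poly size_comp_fXn.
have mon_Q : Q \is monic by rewrite /Q big_seq monic_prod // => P; apply: factor_seq_monic.
have p0 : map_poly psi p != 0 by rewrite map_poly_eq0 -size_poly_gt0 sz_p.
have lp0 : lead_coef (map_poly psi p) != 0 by rewrite lead_coef_eq0.
have pQ : p %| Q.
  rewrite -(dvdp_map psi); have [rs Dp] := closed_field_poly_normal (map_poly psi p).
  have sep : separable_poly (map_poly psi p) by rewrite !separable_map separable_comp_Xn.
  rewrite Dp (eqp_separable (eqp_scale _ lp0)) separable_prod_XsubC in sep.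
  rewrite Dp dvdpZl //; apply: uniq_roots_dvdp; last by rewrite uniq_rootsE.
  apply/allP => y yrs; apply: root_prod_factor_seq; rewrite -/p Dp rootZ //.
  by rewrite root_prod_XsubC.
have /eqpP[[c1 c2] /andP[c10 c20] E] : p %= Q.
  by rewrite -dvdp_size_eqp // sz_p /Q size_prod_factor_seq.
have Ep : p = (c2 / c1) *: Q by rewrite mulrC -scalerA -[_ *: Q]E scalerA mulVf ?scale1r.
have -> : in_alg L (lead_coef f) = lead_coef p.
  rewrite lead_coef_map lead_coef_comp ?size_polyXn ?ltnS //.
  by rewrite lead_coefXn expr1n mulr1.
by rewrite Ep lead_coefZ (eqP mon_Q) mulr1.
Qed.

Lemma descend_factors (s : seq {poly L}) :
  {in s, forall P, P \is monic /\ irreducible_over P} ->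
  exists2 s' : seq {poly F}, s = map (map_poly (in_alg L)) s' &
    forall h, h \in s' -> h \is monic /\ irreducible_poly h.
Proof.
elim: s => [|P s IH] hs; first by exists [::].
have [mon_P [p irr_p Dp]] := hs P (mem_head _ _).
have [|s' Ds hs'] := IH; first by move=> Q Qs; apply: hs; rewrite in_cons Qs orbT.
exists (p :: s'); first by rewrite /= Dp Ds.
move=> h; rewrite in_cons => /predU1P[-> | /hs' //].
by split=> //; rewrite -(map_monic (in_alg L)) -Dp.
Qed.

Lemma size_factor_seq : size factor_seq =
  (\sum_(t <- divisors m | odd t) coprime_count G t + \sum_(t <- divisors m) #|R t|)%N.
Proof.
rewrite size_cat !size_allpairs_dep !sumnE !big_map big_filter; congr (_ + _)%N.
  by apply: eq_bigr => t _; rewrite /coprime_count sum1_count size_filter.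
by apply: eq_bigr => t _; rewrite size_map -cardE.
Qed.

End Setting.

(** A repeated factor would be coprime to itself, hence constant. *)
Lemma uniq_separable_prod (F : fieldType) (s : seq {poly F}) :
  separable_poly (\prod_(h <- s) h) -> {in s, forall h, irreducible_poly h} -> uniq s.
Proof.
elim: s => [|h s IH] //; rewrite big_cons separable_mul => /and3P[_ sep_s cop] irr.
rewrite /= IH // ?andbT; last by move=> g gs; apply: irr; rewrite in_cons gs orbT.
apply/negP => hs; have [sz_h _] := irr h (mem_head _ _).
move: cop; rewrite (big_rem _ hs) /= coprimepMr coprimepp => /andP[/eqP E _].
by rewrite E in sz_h.
Qed.

Theorem theorem4p1
    (F : finFieldType) (q : nat) (hq : #|F| = q) (hq4 : q = 3 %[mod 4])
    (n : nat) (hn0 : (0 < n)%N) (hn8 : (8 %| n)%N)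
    (hnq : forall p : nat, prime p -> (p %| n)%N -> (p %| q - 1)%N)
    (f : {poly F}) (k e : nat) (hirr : irreducible_poly f)
    (hk : size f = k.+1) (hkodd : odd k) (he : poly_has_order f e)
    (hcop : coprime n (e * k))
    (d : nat) (hd : d = gcdn n (q ^ 2 - 1))
    (L : fieldExtType F)
    (* E is the subfield F_(q^2) of the ambient field L *)
    (E : {subfield L}) (hE : \dim E = 2%N)
    (theta : L) (htheta : theta \in E) (hthetad : d.-primitive_root theta)
    (m : nat) (hm : m = (n %/ d)%N)
    (r : nat) (hr0 : (0 < r)%N) (hr : (n * r)%N = 1%N %[mod e])
    (alpha : L) (halpha : root (map_poly (in_alg L) f) alpha)
    (l : nat) (hl : l = minn (logn 2 (n %/ 2)) (logn 2 (q + 1)))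
    (beta : L) (hbeta : beta = theta ^+ (2 ^ l))
    (R : nat -> {set 'I_d.+1})
    (hR : forall t : nat, (t %| m)%N ->
            representatives q (index_set d l t) (R t)) :
  d = (2 ^ l * gcdn n (q - 1))%N
  /\ (gcdn n (q - 1)).-primitive_root beta
  /\ (forall t w : nat, (t %| m)%N -> odd t ->
        (1 <= w <= gcdn n (q - 1))%N -> coprime w t ->
        irreducible_over (factor1 q k r alpha beta t w))
  /\ (forall (t : nat) (u : 'I_d.+1), (t %| m)%N -> u \in R t ->
        irreducible_over (factor2 q k r alpha theta t u))
  /\ map_poly (in_alg L) (f \Po 'X^n) =
       (* the scalar is 1 for monic f *)
       in_alg L (lead_coef f) *:
       ((\prod_(t <- divisors m | odd t)
           \prod_(1 <= w < (gcdn n (q - 1)).+1 | coprime w t)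
              factor1 q k r alpha beta t w)
        * (\prod_(t <- divisors m)
             \prod_(u in R t) factor2 q k r alpha theta t u))
  /\ (exists s : seq {poly F},
        [/\ irreducible_factorization (f \Po 'X^n) s, uniq s
          & (size s)%:R =
            (gcdn n (q - 1))%:R
            * (1 / 2 + 2 ^ (l%:Z - 2) * (2 + (logn 2 m)%:R))
            * \prod_(p <- primes m | odd p)
                (1 + (logn p m)%:R * ((p%:R - 1) / p%:R)) :> rat]).

Proof.
subst q beta.
have [Dd l_gt1] := gcdn_sqr_pred hq4 hn0 hn8 hnq.
rewrite -hd -hl in Dd l_gt1.
have factE := comp_fXn_factorization hq4 hn0 hn8 hnq hirr hk he hd hthetad hm hr halpha l_gt1 Dd hR.
split=> //; split; first exact: (beta_primitive hn0 hthetad Dd).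
split.
  move=> t w tm odd_t _ cop_wt.
  exact: (irreducible_factor1 hq4 hn0 hnq hirr hk he hcop hd hthetad hm hr halpha Dd tm odd_t cop_wt).
split.
  move=> t u tm uR.
  have [cop_ut lu] := R_index hR tm uR.
  exact: (irreducible_factor2 hq4 hn0 hn8 hnq hirr hk he hcop hd hthetad hm hr halpha Dd tm cop_ut lu).
split; first by rewrite factE prod_factor_seq.
have irr_factor P : P \in factor_seq n k theta m r alpha l R -> P \is monic /\ irreducible_over P.
  move=> Pin; split; first exact: (factor_seq_monic hn0 hd hthetad hm Pin).
  exact: (factor_seq_irreducible hq4 hn0 hn8 hnq hirr hk he hcop hd hthetad hm hr halpha Dd hR).
have [s Ds hs] := descend_factors irr_factor.
have mon_s : \prod_(h <- s) h \is monic.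
  by rewrite big_seq monic_prod // => h /hs[].
have Es : f \Po 'X^n = lead_coef f *: \prod_(h <- s) h.
  apply: (map_poly_inj (in_alg L)).
  by rewrite factE map_polyZ rmorph_prod Ds big_map.
have lf0 : lead_coef f != 0 by rewrite lead_coef_eq0 -size_poly_gt0 hk.
exists s; split.
- by split=> //; rewrite {2}Es lead_coefZ (eqP mon_s) mulr1.
- apply: uniq_separable_prod => [|h /hs[] //].
  rewrite -(eqp_separable (eqp_scale _ lf0)) -Es.
  exact: (separable_comp_Xn hq4 hn0 hnq hirr hk he halpha).
rewrite -(size_map (map_poly (in_alg L)) s) -Ds size_factor_seq.
apply: total_count => //.
- exact: (m_gt0 hn0 hd hthetad hm).
- exact: (rad_m hnq hd hm).
move=> t tm; rewrite -Dd.
exact: (card_index_set_R hq4 hn0 hn8 hnq hd hthetad hm Dd hR).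
Qed.
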